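(* Consider the torus $M=\mathbf R^6/\mathbf Z^6$ with coordinates $x^1,\dots,x^6$ and the symplectic form $\omega=dx^{12}+dx^{34}+dx^{56}$. Consider the source-free Type IIA flow $\partial_t\varphi=d\Lambda d(|\varphi|^2\star\varphi)$ with positive initial data of the form $$\varphi_0=e^{\alpha}dx^{135}-e^{\beta}dx^{146}-dx^{245}-dx^{236}+\gamma\,dx^{136}+\delta\,dx^{145},$$ where $\alpha,\beta,\gamma,\delta:\mathbf R/\mathbf Z\to\mathbf R$ are smooth functions depending only on the variable $x^1$, and such that $J_{\varphi_0}$ is non-integrable. Then the flow exists for all time, and $\varphi$ converges as $t\to\infty$ to a positive harmonic form.
   Context: Notation: $dx^{ij}=dx^i\wedge dx^j$, $dx^{ijk}=dx^i\wedge dx^j\wedge dx^k$. Forms $\varphi_0$ as in the claim are automatically closed and primitive. Type IIA conventions on a symplectic $6$-manifold $(M,\omega)$, oriented by $\omega^3$. For a $3$-form $\varphi$ set, pointwise, $K_\varphi(v)=-\sum_i e_i\otimes(e^i\wedge\iota_v\varphi\wedge\varphi)\in TM\otimes\Lambda^6T^*M$ and $\lambda_\varphi=\frac16\mathrm{tr}\,K_\varphi^2$. If $\lambda_\varphi<0$, then $J_\varphi=K_\varphi/\sqrt{-\lambda_\varphi}$ (positive root) is an almost-complex structure (Hitchin). $\Lambda$ is contraction with $\omega$: $(\Lambda\alpha)_{k\cdots}=\frac12\omega^{ji}\alpha_{ijk\cdots}$, $\omega^{jk}\omega_{kl}=\delta^j{}_l$. $\varphi$ is primitive if $\Lambda\varphi=0$;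 then $g_\varphi(X,Y)=\omega(X,J_\varphi Y)$ is symmetric. $\varphi$ is positive if $\lambda_\varphi<0$ and $g_\varphi$ is positive definite. $\star$ and $|\varphi|$ ($|\varphi|^2=\frac16\varphi_{ijk}\varphi^{ijk}$) are with respect to $g_\varphi$. A positive primitive form $\varphi$ is harmonic if it is harmonic with respect to $g_\varphi$. *)

(* Defs.v *)
From HB Require Import structures.
From mathcomp Require Import all_boot all_order all_algebra all_fingroup.
From mathcomp Require Import all_classical all_reals all_analysis.

Set Implicit Arguments.
Unset Strict Implicit.
Unset Printing Implicit Defensive.

Import Order.TTheory GRing.Theory Num.Theory numFieldNormedType.Exports.

Local Open Scope classical_set_scope.
Local Open Scope ring_scope.

(* The torus is R^6/Z^6: its tensor fields are the Z^6-periodic fields on R^6,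
   written in the global frame dx^1, ..., dx^6. *)

Definition R6 (R : realType) := 'rV[R]_6.

(* Coordinates are numbered from 1: [ix 1], ..., [ix 6] enumerate 'I_6. *)
Definition ix (n : nat) : 'I_6 := inord n.-1.

Section Functions.
Variable R : realType.

Definition basis_vec (i : 'I_6) : R6 R := delta_mx 0 i.

Definition pderiv (i : 'I_6) (f : R6 R -> R) : R6 R -> R :=
  fun x => 'D_(basis_vec i) f x.

Definition pderivs (s : seq 'I_6) (f : R6 R -> R) : R6 R -> R :=
  foldr pderiv f s.

Definition smooth_fun (f : R6 R -> R) : Prop :=
  forall s : seq 'I_6,
    continuous (pderivs s f) /\
    forall i x, derivable (pderivs s f) x (basis_vec i).

Definition periodic_fun (f : R6 R -> R) : Prop :=
  forall i x, f (x + basis_vec i) = f x.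

Definition smooth_circle_fun (a : R -> R) : Prop :=
  (forall n x, derivable (derive1n n a) x 1) /\ (forall x, a (x + 1) = a x).

End Functions.

Section Tensors.
Variable R : realType.

(* Components alpha_{i_1 ... i_k} of a covariant k-tensor. *)
Definition tensor (k : nat) := k.-tuple 'I_6 -> R.

Definition tensor_field (k : nat) := R6 R -> tensor k.

Definition alternating_tensor k (a : tensor k) : Prop :=
  forall (s : 'S_k) (I : k.-tuple 'I_6),
    a [tuple tnth I (s j) | j < k] = (-1) ^+ s * a I.

Definition torus_form k (a : tensor_field k) : Prop :=
  (forall x, alternating_tensor (a x)) /\
  (forall I, smooth_fun (a^~ I)) /\ (forall I, periodic_fun (a^~ I)).

(* Normalized so that dx^i /\ dx^j = dx^i (x) dx^j - dx^j (x) dx^i. *)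
Definition wedge_prod p q (a : tensor p) (b : tensor q) : tensor (p + q) :=
  fun I => (p`! * q`!)%:R^-1 *
    \sum_(s : 'S_(p + q)) (-1) ^+ s *
       a [tuple tnth I (s (lshift q j)) | j < p] *
       b [tuple tnth I (s (rshift p j)) | j < q].

Definition covec (i : 'I_6) : tensor 1 := fun I => (tnth I ord0 == i)%:R.

Definition dx2 (i j : nat) : tensor 2 :=
  wedge_prod (covec (ix i)) (covec (ix j)).

Definition dx3 (i j k : nat) : tensor 3 :=
  wedge_prod (covec (ix i)) (wedge_prod (covec (ix j)) (covec (ix k))).

(* Contraction with the coordinate vector e_i in the first slot. *)
Definition contract k (i : 'I_6) (a : tensor k.+1) : tensor k :=
  fun I => a [tuple of i :: I].

Definition ext_d k (a : tensor_field k) : tensor_field k.+1 :=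
  fun x I => \sum_(j < k.+1) (-1) ^+ j *
    pderiv (tnth I j) (fun y => a y [tuple tnth I (lift j l) | l < k]) x.

Definition closed_form k (a : tensor_field k) : Prop :=
  forall x I, ext_d a x I = 0.

Definition omega_form : tensor 2 := fun I => dx2 1 2 I + dx2 3 4 I + dx2 5 6 I.

(* omega_{ij}; the inverse matrix is omega^{ij}. *)
Definition omega_mx : 'M[R]_6 := \matrix_(i, j) omega_form [tuple i; j].

Definition Lam k (a : tensor k.+2) : tensor k :=
  fun I => 2^-1 * \sum_(i < 6) \sum_(j < 6)
    invmx omega_mx j i * a [tuple of i :: j :: I].

Definition primitive_form (a : tensor_field 3) : Prop :=
  forall x I, Lam (a x) I = 0.

(* The line Lambda^6 T^*M is identified with R through
   dx^{123456} = omega^3 / 6, whose coefficient is read on [ord_tuple 6].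
   The (i, j) entry is the e_i-component of K_phi(e_j). *)
Definition K_mx (p : tensor 3) : 'M[R]_6 :=
  \matrix_(i, j)
    - wedge_prod (covec i) (wedge_prod (contract j p) p) (ord_tuple 6).

Definition hitchin_lambda (p : tensor 3) : R := 6^-1 * \tr (K_mx p *m K_mx p).

Definition J_mx (p : tensor 3) : 'M[R]_6 :=
  (Num.sqrt (- hitchin_lambda p))^-1 *: K_mx p.

(* g_phi(X, Y) = omega(X, J_phi Y). *)
Definition g_mx (p : tensor 3) : 'M[R]_6 := omega_mx *m J_mx p.

Definition positive_form (a : tensor_field 3) : Prop :=
  forall x, hitchin_lambda (a x) < 0 /\
    forall v : 'rV[R]_6, v != 0 -> 0 < (v *m g_mx (a x) *m v^T) 0 0.

(* Vector fields are rows of components; (J X)^k = J^k_l X^l. *)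
Definition apply_J (J : R6 R -> 'M[R]_6) (X : R6 R -> 'rV[R]_6) :=
  fun x => X x *m (J x)^T.

Definition lie_bracket (X Y : R6 R -> 'rV[R]_6) : R6 R -> 'rV[R]_6 :=
  fun x => \row_k \sum_(l < 6)
    (X x 0 l * pderiv l (fun y => Y y 0 k) x
     - Y x 0 l * pderiv l (fun y => X y 0 k) x).

Definition nijenhuis (J : R6 R -> 'M[R]_6) (X Y : R6 R -> 'rV[R]_6)
    : R6 R -> 'rV[R]_6 :=
  fun x => lie_bracket (apply_J J X) (apply_J J Y) x
    - apply_J J (lie_bracket (apply_J J X) Y) x
    - apply_J J (lie_bracket X (apply_J J Y)) x
    - lie_bracket X Y x.

Definition torus_vector_field (X : R6 R -> 'rV[R]_6) : Prop :=
  forall k, smooth_fun (fun x => X x 0 k) /\ periodic_fun (fun x => X x 0 k).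

(* Vanishing of the Nijenhuis tensor. *)
Definition integrable_acs (J : R6 R -> 'M[R]_6) : Prop :=
  forall X Y, torus_vector_field X -> torus_vector_field Y ->
    forall x, nijenhuis J X Y x = 0.

(* For s of length 6: the sign of s if it is a permutation of the indices,
   and 0 otherwise. *)
Definition levi_civita (s : seq 'I_6) : R :=
  \det (\matrix_(a < 6, b < 6) (nth ord0 s a == b)%:R).

Definition raise_indices (g : 'M[R]_6) k (a : tensor k) : tensor k :=
  fun I => \sum_(L : k.-tuple 'I_6)
    (\prod_(m < k) invmx g (tnth I m) (tnth L m)) * a L.

Definition norm_sq (g : 'M[R]_6) k (a : tensor k) : R :=
  k`!%:R^-1 * \sum_(I : k.-tuple 'I_6) a I * raise_indices g a I.

(* alpha /\ star beta = <alpha, beta> vol_g, for the orientation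
   dx^{123456} > 0 given by omega^3. *)
Definition hodge (g : 'M[R]_6) k (a : tensor k) : tensor (6 - k) :=
  fun J => k`!%:R^-1 * Num.sqrt (\det g) *
    \sum_(I : k.-tuple 'I_6) raise_indices g a I * levi_civita (I ++ J).

Definition hodge_field (g : R6 R -> 'M[R]_6) k (a : tensor_field k)
    : tensor_field (6 - k) :=
  fun x => hodge (g x) (a x).

(* In even dimension d^* = - star d star in every degree. *)
Definition codiff (g : R6 R -> 'M[R]_6) k (a : tensor_field k)
    : tensor_field (6 - (6 - k).+1) :=
  fun x I => - hodge_field g (ext_d (hodge_field g a)) x I.

Definition hodge_laplacian3 (g : R6 R -> 'M[R]_6) (a : tensor_field 3)
    : tensor_field 3 :=
  fun x I => ext_d (codiff g a : tensor_field 2) x I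
           + (codiff g (ext_d a) : tensor_field 3) x I.

Definition metric_of (a : tensor_field 3) : R6 R -> 'M[R]_6 :=
  fun x => g_mx (a x).

Definition harmonic_form (a : tensor_field 3) : Prop :=
  forall x I, hodge_laplacian3 (metric_of a) a x I = 0.

Definition typeIIA_rhs (a : tensor_field 3) : tensor_field 3 :=
  let star_a : tensor_field 3 := hodge_field (metric_of a) a in
  let b : tensor_field 3 :=
    fun x I => norm_sq (metric_of a x) (a x) * star_a x I in
  ext_d (fun x => Lam (ext_d b x)).

End Tensors.

Section Flow.
Variable R : realType.

(* v is the time derivative of u on [0, +oo), one-sided at time 0. *)
Definition time_derivative (u v : R -> R6 R -> R) : Prop :=
  forall t x, 0 <= t ->
    (s - t)^-1 * (u s x - u t x)
      @[s --> within [set s | 0 <= s] t^'] --> v t x.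

(* u is C^oo on [0, +oo) x R^6, up to the boundary: D n s is the derivative
   of order n in time and multi-index s in space. *)
Definition spacetime_smooth (u : R -> R6 R -> R) : Prop :=
  exists D : nat -> seq 'I_6 -> R -> R6 R -> R,
    [/\ forall t x, 0 <= t -> D 0%N [::] t x = u t x,
        forall n s,
          {within [set p : R * R6 R | 0 <= p.1],
             continuous (fun p : R * R6 R => D n s p.1 p.2)},
        forall n s, time_derivative (D n s) (D n.+1 s)
      & forall n s i t x, 0 <= t ->
          is_derive x (basis_vec R i) (D n s t) (D n (i :: s) t x)].

(* A smooth solution on [0, +oo) of the source-free Type IIA flow. *)
Definition typeIIA_flow (phi : R -> tensor_field R 3) : Prop :=
  [/\ forall t, 0 <= t ->
        [/\ torus_form (phi t), closed_form (phi t), primitive_form (phi t)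
          & positive_form (phi t)],
      forall I, spacetime_smooth (fun t x => phi t x I)
    & forall I, time_derivative (fun t x => phi t x I)
                                (fun t x => typeIIA_rhs (phi t) x I)].

(* Convergence in the C^oo topology as t -> +oo. *)
Definition converges_smoothly k (phi : R -> tensor_field R k)
    (psi : tensor_field R k) : Prop :=
  forall (s : seq 'I_6) (I : k.-tuple 'I_6) (e : R), 0 < e ->
    \forall t \near +oo, forall x,
      `|pderivs s (fun y => phi t y I - psi y I) x| < e.

Definition phi_init (alpha beta gamma delta : R -> R) : tensor_field R 3 :=
  fun x I => let x1 := x 0 (ix 1) in
    expR (alpha x1) * dx3 R 1 3 5 I - expR (beta x1) * dx3 R 1 4 6 I
    - dx3 R 2 4 5 I - dx3 R 2 3 6 I
    + gamma x1 * dx3 R 1 3 6 I + delta x1 * dx3 R 1 4 5 I.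

End Flow.

(* Main.v *)
Require Import Defs.
From HB Require Import structures.
From mathcomp Require Import all_boot all_order all_algebra all_fingroup.
From mathcomp Require Import all_classical all_reals all_analysis.
From mathcomp Require Import measurable_realfun.
From mathcomp Require Import ring lra.
Set Implicit Arguments.
Unset Strict Implicit.
Unset Printing Implicit Defensive.
Import Order.TTheory GRing.Theory Num.Theory numFieldNormedType.Exports.
Local Open Scope classical_set_scope.
Local Open Scope ring_scope.

(** The ansatz is preserved by the flow, which becomes a linear heat equation
    on it.

    Write phi = dx^1 /\ P + dx^2 /\ Q with
    P = a dx^35 - b dx^46 + c dx^36 + d dx^45 and Q = - dx^45 - dx^36, where
    a, b, c, d depend on x^1.  Pointwise everything is governed by
    D = 4 a b - (c - d)^2.  The endomorphism K_phi consists of three 2 x 2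
    blocks and satisfies K_phi^2 = - D, so phi is positive exactly when a, b
    and D are (hitchin_lambda_phi, g_mx_pos).  Moreover |phi|^2 = 2 sqrt D,
    and star phi is D^(-1/2) times a form whose coefficients are polynomials
    in a, b, c, d (norm_sq_phi, hodge_phi).  In |phi|^2 star phi the square
    roots cancel.  Since the coefficients depend on x^1 only, the terms with
    dx^1 are killed by d, and the remaining terms are
    dx^2 /\ (4 a dx^35 + 2 (c - d) (dx^36 - dx^45) - 4 b dx^46).
    On these d Lambda d replaces dx^2 by dx^1 and differentiates the
    coefficients twice (typeIIA_rhs_IIA): a, b and c - d solve u_t = 4 u'', and
    c + d does not move.

    The heat equation is solved by Gaussian averages,
    u(t, x) = \int f (x + 4 sqrt t z) exp (- z^2) / sqrt pi dz.
    All space derivatives of u are averages of derivatives of f.  The time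
    derivative is computed by an integration by parts in z (heat_avg_stein,
    heat_dt); it has the same shape with f'' in place of f, so that u is
    smooth up to t = 0.  The same integration by parts, applied to a periodic
    primitive of f minus its mean, bounds u minus the mean of f by a multiple
    of t^(-1/2), and likewise for every derivative of u.

    Positivity of a, b and D says that a X^2 + (c - d) X + b is positive for
    every real X.  Averages of positive functions are positive, so this
    persists along the flow and for the limit (pencil_pos).  In the limit a, b
    and c - d are constant; then D and the part of star phi without dx^1 are
    constant, whence d star phi = 0 and the limit is harmonic
    (IIA_form_harmonic). *)

(** * Expansions of wedge products *)

Section Wedge.
Variable R : realType.

(** A permutation of n + 1 letters amounts to the image j of the first one and
    a permutation of the others; this is the inductive step behind the
    expansions of wedge products. *)
Lemma sum_perm_split n (F : 'S_n.+1 -> R) :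
  \sum_s F s = \sum_(j < n.+1) \sum_(t : 'S_n) F (lift_perm ord0 j t).
Proof.
rewrite pair_bigA /=; apply: reindex; apply: onW_bij; apply: inj_card_bij.
  move=> [j t] [j' t'] /= e.
  have ej : j = j' by rewrite -[LHS](lift_perm_id ord0 j t) e lift_perm_id.
  subst j'; congr (_, _); apply/permP => k; apply: (@lift_inj _ j).
  by rewrite -!(lift_perm_lift ord0) e.
by rewrite card_prod card_ord !card_Sn factS.
Qed.

Lemma wedge_alternating p q (a : tensor R p) (b : tensor R q) :
  alternating_tensor (wedge_prod a b).
Proof.
move=> s I; rewrite /wedge_prod mulrCA; congr (_ * _).
rewrite [in RHS](reindex_inj (mulIg s)) /= big_distrr /=.
apply: eq_bigr => t _; rewrite !mulrA.
have -> : (-1) ^+ t = (-1) ^+ s * (-1) ^+ (t * s)%g :> R.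
  by rewrite odd_permM addbC -!signr_addb addKb.
by congr (_ * a _ * b _); apply: eq_from_tnth => j; rewrite !tnth_mktuple permM.
Qed.

(** Laplace expansion along the first factor.  The permutations are grouped by
    the position j that feeds [covec]; since b alternates, the q! terms of a
    group coincide and cancel the normalization. *)
Lemma wedge_covec q (i : 'I_6) (b : tensor R q) (I : q.+1.-tuple 'I_6) :
  alternating_tensor b ->
  wedge_prod (covec R i) b I =
  \sum_(j < q.+1) (-1) ^+ j * (tnth I j == i)%:R *
                  b [tuple tnth I (lift j l) | l < q].
Proof.
move=> hb; rewrite /wedge_prod (@sum_perm_split q) (_ : 1`! = 1)%N // mul1n.
rewrite big_distrr /=; apply: eq_bigr => j _.
pose J : q.-tuple 'I_6 := [tuple tnth I (lift j l) | l < q].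
rewrite (eq_bigr (fun=> (-1) ^+ j * (tnth I j == i)%:R * b J)); last first.
  move=> t _; rewrite odd_lift_perm /=.
  rewrite signr_addb signr_odd /covec tnth_mktuple.
  rewrite (_ : lshift q ord0 = ord0); last exact/val_inj.
  rewrite lift_perm_id.
  rewrite (_ : [tuple _ | j0 < q] = [tuple tnth J (t l) | l < q]); last first.
    apply: eq_from_tnth => l; rewrite !tnth_mktuple.
    rewrite (_ : rshift 1 l = lift ord0 l); last exact/val_inj.
    by rewrite lift_perm_lift.
  rewrite hb; set e := (-1) ^+ nat_of_bool (odd_perm t).
  have e2 : e * e = 1 by rewrite -expr2 sqrr_sign.
  by rewrite mulrACA -[_ * e * e]mulrA e2 mulr1 mulrA.
by rewrite sumr_const card_Sn -[X in _ * X]mulr_natl mulKf.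
Qed.

Lemma covec_alternating i : alternating_tensor (covec R i).
Proof.
move=> s I; have -> : s = 1%g by apply/permP => x; rewrite !ord1.
rewrite odd_perm1 expr0 mul1r; congr covec.
by apply: eq_from_tnth => j; rewrite tnth_mktuple perm1.
Qed.

Lemma wedge_covec2 k l (I : 2.-tuple 'I_6) :
  wedge_prod (covec R k) (covec R l) I =
  (tnth I ord0 == k)%:R * (tnth I ord_max == l)%:R -
  (tnth I ord_max == k)%:R * (tnth I ord0 == l)%:R.
Proof.
rewrite (@wedge_covec 1); last exact: covec_alternating.
rewrite big_ord_recl big_ord1 /= expr0 mul1r expr1 mulN1r mulNr /covec !tnth_mktuple.
rewrite (_ : lift ord0 ord0 = ord_max); last exact/val_inj.
by rewrite (_ : lift ord_max ord0 = ord0); last exact/val_inj.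
Qed.

(** Antisymmetry of dx^k /\ dx^l makes the two halves of the defining sum equal
    up to the transposition of the first two slots, which absorbs the factor
    2! of the normalization. *)
Lemma wedge_covecA q k l (b : tensor R q) (I : q.+2.-tuple 'I_6) :
  alternating_tensor b ->
  wedge_prod (wedge_prod (covec R k) (covec R l)) b I =
  wedge_prod (covec R k) (wedge_prod (covec R l) b) I.
Proof.
move=> hb; rewrite [RHS](@wedge_covec q.+1); last exact: (@wedge_alternating 1 q).
pose F (s : 'S_q.+2) : R := (-1) ^+ s * (tnth I (s ord0) == k)%:R *
  (tnth I (s (lift ord0 ord0)) == l)%:R *
  b [tuple tnth I (s (lift ord0 (lift ord0 j))) | j < q].
have -> : wedge_prod (wedge_prod (covec R k) (covec R l)) b I =
    (q`!)%:R^-1 * \sum_s F s.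
  pose tau : 'S_q.+2 := tperm ord0 (lift ord0 ord0).
  have eF : \sum_s F s = \sum_s F (tau * s)%g by rewrite (reindex_inj (mulgI tau)).
  have -> : \sum_s F s = 2^-1 * \sum_s (F s + F (tau * s)%g).
    by rewrite big_split /= -eF; field.
  rewrite {1}/wedge_prod mulrA -invfM -natrM mulnC; congr (_ * _).
  apply: eq_bigr => s _; rewrite wedge_covec2 !tnth_mktuple /F.
  rewrite odd_mul_tperm /= !permM tpermL tpermR.
  have -> : @lshift 2 q ord0 = ord0 :> 'I_q.+2 by exact/val_inj.
  have -> : @lshift 2 q ord_max = lift ord0 ord0 :> 'I_q.+2 by exact/val_inj.
  rewrite (_ : [tuple _ | j < q] =
      [tuple tnth I (s (lift ord0 (lift ord0 j))) | j < q]); last first.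
    by apply: eq_from_tnth => j; rewrite !tnth_mktuple; congr (tnth I (s _));
        exact/val_inj.
  rewrite [X in _ = _ + _ * b X](_ : _ =
      [tuple tnth I (s (lift ord0 (lift ord0 j))) | j < q]); last first.
    by apply: eq_from_tnth => j; rewrite !tnth_mktuple permM tpermD.
  by rewrite signrN mulrBr mulrBl !mulNr !mulrA.
rewrite sum_perm_split big_distrr /=; apply: eq_bigr => j _.
rewrite /wedge_prod (_ : 1`! = 1)%N // mul1n mulrCA; congr (_ * _).
rewrite big_distrr /=; apply: eq_bigr => t _.
rewrite /F odd_lift_perm /= signr_addb signr_odd !lift_perm_id !lift_perm_lift.
rewrite /covec !tnth_mktuple.
have -> : @lshift 1 q ord0 = ord0 by exact/val_inj.
rewrite !mulrA; congr (_ * b _); first by congr (_ * _); rewrite mulrAC.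
apply: eq_from_tnth => i; rewrite !tnth_mktuple !lift_perm_lift.
by congr (tnth I (lift j (t _))); exact/val_inj.
Qed.

End Wedge.

(** * Determinants of index lists *)

(** Expansion of a determinant along a row that has a 1 exactly at the entries
    of the second list equal to x; f evaluates the complementary minor and
    [pre] holds, in reverse order, the entries already passed. *)
Fixpoint list_det_row (A : nzRingType) (x : nat) (f : seq nat -> A)
    (pre l : seq nat) : A :=
  if l is y :: l' then
    (if x == y then f (catrev pre l') else 0) - list_det_row x f (y :: pre) l'
  else 0.

(** The determinant of the 0-1 matrix with a 1 where an entry of s equals an
    entry of l.  It is the value of the wedge of the covectors indexed by s on
    the basis vectors indexed by l, in a form that computes on explicit
    lists. *)
Fixpoint list_det (A : nzRingType) (s : seq nat) : seq nat -> A :=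
  if s is x :: s' then list_det_row x (list_det A s') [::] else fun=> 1.
Arguments list_det : clear implicits.

Section Ldet.
Variable A : nzRingType.

Lemma list_det_cons x s l :
  list_det A (x :: s) l =
  \sum_(k < size l) (-1) ^+ k * (x == nth 0%N l k)%:R *
                    list_det A s (take k l ++ drop k.+1 l).
Proof.
suff H pre : list_det_row x (list_det A s) pre l =
  \sum_(k < size l) (-1) ^+ k * (x == nth 0%N l k)%:R *
                    list_det A s (catrev pre (take k l ++ drop k.+1 l)).
  exact: H.
elim: l pre => [|y l IHl] pre; first by rewrite big_ord0.
rewrite big_ord_recl /= IHl ?take0 ?drop0 /= expr0 mul1r.
congr (_ + _); first by case: eqP => _; rewrite ?mul1r ?mul0r.
rewrite -sumrN; apply: eq_bigr => k _.
by rewrite /bump /= add1n exprS mulN1r !mulNr.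
Qed.

End Ldet.

(** Integer values allow explicit determinants to be evaluated by
    computation. *)
Lemma list_det_int (A : nzRingType) s l : list_det A s l = (list_det int s l)%:~R.
Proof.
elim: s l => [|x s IHs] l; first by [].
rewrite !list_det_cons rmorph_sum /=; apply: eq_bigr => k _.
by rewrite IHs !rmorphM /= rmorphXn /= rmorphN1 rmorph_nat.
Qed.

Lemma det_list_det (A : comNzRingType) n (s l : seq nat) :
  size s = n -> size l = n ->
  \det (\matrix_(a < n, b < n) (nth 0%N s a == nth 0%N l b)%:R) = list_det A s l.
Proof.
elim: n s l => [|n IHn] [|x s] // l; first by move=> *; rewrite det_mx00.
case=> ss sl; rewrite (expand_det_row _ ord0) list_det_cons sl.
apply: eq_bigr => k _; rewrite mxE /= -[RHS]mulrA [RHS]mulrCA; congr (_ * _).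
rewrite /cofactor add0n; congr (_ * _).
have kl : (k < size l)%N by rewrite sl.
rewrite -(IHn s) //; last first.
  by rewrite size_cat size_drop (size_takel (ltnW kl)) sl subSS subnKC // -ltnS.
congr (\det _); apply/matrixP => a b; rewrite !mxE /=.
rewrite add0n; congr (nat_of_bool (_ == _))%:R.
rewrite nth_cat (size_takel (ltnW kl)).
rewrite nth_drop /bump; case: (ltnP b k) => bk; first by rewrite nth_take.
by rewrite addSn subnKC.
Qed.

Section Dx.
Variable R : realType.

Notation ix_ I := (map (@nat_of_ord 6) (val I)).

Lemma map_ord_rem n (I : n.+1.-tuple 'I_6) (j : 'I_n.+1) :
  ix_ [tuple tnth I (lift j l) | l < n] = take j (ix_ I) ++ drop j.+1 (ix_ I).
Proof.
have jn : (j < size (ix_ I))%N by rewrite size_map size_tuple.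
apply: (@eq_from_nth _ 0%N).
  rewrite size_cat size_drop (size_takel (ltnW jn))
      [in LHS]size_map [in LHS]size_tuple [in RHS]size_map.
  by rewrite [in RHS]size_tuple subSS subnKC ?leq_ord.
move=> k; rewrite size_map size_tuple => kn.
rewrite (nth_map ord0) ?size_tuple //.
rewrite -[k]/(nat_of_ord (Ordinal kn)) -tnth_nth tnth_mktuple.
rewrite (tnth_nth ord0) -(nth_map ord0 0%N (@nat_of_ord 6)) ?size_tuple //.
rewrite nth_cat.
rewrite (size_takel (ltnW jn)).
rewrite nth_drop /= /bump; case: (ltnP k j) => kj.
  by rewrite nth_take.
by rewrite addSn subnKC.
Qed.

Lemma wedge_covec_list_det q (i : 'I_6) (b : tensor R q) s :
  alternating_tensor b -> (forall J, b J = list_det R s (ix_ J)) ->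
  forall I : q.+1.-tuple 'I_6,
  wedge_prod (covec R i) b I = list_det R (nat_of_ord i :: s) (ix_ I).
Proof.
move=> hb bE I; rewrite (wedge_covec _ _ hb) list_det_cons size_map size_tuple.
apply: eq_bigr => j _; rewrite bE map_ord_rem eq_sym.
rewrite (nth_map ord0) ?size_tuple // -tnth_nth.
by congr (_ * _ * _).
Qed.

Lemma covec_list_det i I : covec R i I = list_det R [:: nat_of_ord i] (ix_ I).
Proof.
case: I => -[|x [|//]] // sI; rewrite /covec /= (tnth_nth ord0) /= subr0.
by rewrite eq_sym -val_eqE; case: eqP.
Qed.

Lemma wedge2_list_det i j (I : 2.-tuple 'I_6) :
  wedge_prod (covec R i) (covec R j) I =
  list_det R [:: nat_of_ord i; nat_of_ord j] (ix_ I).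
Proof.
apply: (@wedge_covec_list_det 1); first exact: covec_alternating.
exact: covec_list_det.
Qed.

Lemma wedge3_list_det i j k (I : 3.-tuple 'I_6) :
  wedge_prod (covec R i) (wedge_prod (covec R j) (covec R k)) I =
  list_det R [:: nat_of_ord i; nat_of_ord j; nat_of_ord k] (ix_ I).
Proof.
apply: (@wedge_covec_list_det 2); first exact: (@wedge_alternating _ 1 1).
exact: wedge2_list_det.
Qed.

Lemma ixE n : (0 < n <= 6)%N -> nat_of_ord (ix n) = n.-1.
Proof. by case: n => // n /andP[_ n6]; rewrite /ix inordK. Qed.

Lemma levi_civitaE (s : seq 'I_6) : size s = 6%N ->
  levi_civita R s = list_det R (map (@nat_of_ord 6) s) (iota 0 6).
Proof.
move=> ss; rewrite -(@det_list_det _ 6) ?size_map //.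
congr (\det _); apply/matrixP => a b; rewrite !mxE.
by rewrite (nth_map ord0) ?ss // nth_iota // add0n -val_eqE.
Qed.

End Dx.

(** * Forms with one index in each symplectic pair *)

Notation nat_indices I := (map (@nat_of_ord 6) (val I)).

Definition slots : seq (bool * bool * bool) :=
  [:: (false, false, false); (false, false, true); (false, true, false);
      (false, true, true); (true, false, false); (true, false, true);
      (true, true, false); (true, true, true)].

(** The three zero-based indices picked by a triple of booleans, one in each of
    the pairs {0, 1}, {2, 3}, {4, 5} on which omega is supported. *)
Definition slot (e : bool * bool * bool) : seq nat :=
  [:: if e.1.1 then 1 else 0; if e.1.2 then 3 else 2; if e.2 then 5 else 4]%N.

(** The contribution of dx^e (contracted with the j-th vector) and dx^f to the
    entry (i, j) of the quadratic map K.  The three summands come from the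
    three factors of dx^e that can absorb the vector. *)
Definition K_term (i j : nat) (e f : bool * bool * bool) : int :=
  let: (x, y, z) := (if e.1.1 then 1 else 0, if e.1.2 then 3 else 2,
      if e.2 then 5 else 4)%N in
    (if x == j then list_det int ([:: i; y; z] ++ slot f) (iota 0 6) else 0)
  - (if y == j then list_det int ([:: i; x; z] ++ slot f) (iota 0 6) else 0)
  + (if z == j then list_det int ([:: i; x; y] ++ slot f) (iota 0 6) else 0).

Definition K_table (i j : nat) :
    seq (bool * bool * bool * (bool * bool * bool) * int) :=
  [seq t <- [seq (e, f, K_term i j e f) | e <- slots, f <- slots] | t.2 != 0].

Section SplitForms.
Variable R : realType.

(** Kept as a named function so that polynomial identities treat it as an
    indeterminate. *)
Definition kron (x y : nat) : R := if x == y then 1 else 0.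

Lemma if_kron x y (u : R) : (if x == y then u else 0) = kron x y * u.
Proof. by rewrite /kron; case: eqP; rewrite ?mul1r ?mul0r. Qed.

Lemma list_det2E a b u v :
  list_det R [:: a; b] [:: u; v] = kron a u * kron b v - kron a v * kron b u.
Proof. by rewrite /= !if_kron; ring. Qed.

Lemma list_det3E a b c u v w :
  list_det R [:: a; b; c] [:: u; v; w] =
    kron a u * (kron b v * kron c w - kron b w * kron c v)
  - kron a v * (kron b u * kron c w - kron b w * kron c u)
  + kron a w * (kron b u * kron c v - kron b v * kron c u).
Proof. by rewrite /= !if_kron; ring. Qed.

(** All 3-forms met in the proof lie in the span of the eight dx^pqr with one
    index in each symplectic pair: it is stable under raising indices and under
    the Hodge star, because the metrics involved are block diagonal. *)
Definition split_form (T : bool * bool * bool -> R) : tensor R 3 :=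
  fun I => \sum_(e <- slots) T e * list_det R (slot e) (nat_indices I).

Lemma tuple2_eta (I : 2.-tuple 'I_6) : exists x y, I = [tuple x; y].
Proof.
case: I => -[|x [|y [|//]]] // hI.
by exists x, y; apply: val_inj.
Qed.

Lemma tuple3_eta (I : 3.-tuple 'I_6) : exists x y z, I = [tuple x; y; z].
Proof.
case: I => -[|x [|y [|z [|//]]]] // hI.
by exists x, y, z; apply: val_inj.
Qed.

Lemma dx3E i j k I : (0 < i <= 6)%N -> (0 < j <= 6)%N -> (0 < k <= 6)%N ->
  dx3 R i j k I = list_det R [:: i.-1; j.-1; k.-1] (nat_indices I).
Proof. by move=> hi hj hk; rewrite /dx3 wedge3_list_det !ixE. Qed.

(** Bilinearity reduces K of a combination of basis forms to a table of
    integers. *)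
Lemma wedge_prod_sum (E F : Type) (r : seq E) (s : seq F) p q
  (c : E -> R) (d : F -> R) (a : E -> tensor R p) (b : F -> tensor R q) I :
  wedge_prod (fun J => \sum_(e <- r) c e * a e J)
             (fun J => \sum_(f <- s) d f * b f J) I =
  \sum_(e <- r) \sum_(f <- s) c e * d f * wedge_prod (a e) (b f) I.
Proof.
rewrite /wedge_prod.
under [RHS]eq_bigr do under eq_bigr do rewrite mulrCA.
under [RHS]eq_bigr do rewrite -big_distrr /=.
rewrite -big_distrr /=; congr (_ * _).
under [RHS]eq_bigr do under eq_bigr do rewrite big_distrr /=.
under [RHS]eq_bigr do rewrite exchange_big /=.
rewrite exchange_big /=; apply: eq_bigr => t _.
rewrite -mulrA big_distrlr /= big_distrr; apply: eq_bigr => e _.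
rewrite big_distrr; apply: eq_bigr => f _ /=.
by rewrite mulrACA [LHS]mulrCA !mulrA.
Qed.

Definition wedge_of (k l : nat) : tensor R 2 :=
  wedge_prod (covec R (inord k)) (covec R (inord l)).

Definition wedge3_of (s : seq nat) : tensor R 3 :=
  wedge_prod (covec R (inord (nth 0%N s 0))) (wedge_of (nth 0%N s 1) (nth 0%N s 2)).

Lemma split_formE T :
  split_form T = fun I => \sum_(e <- slots) T e * wedge3_of (slot e) I.
Proof.
apply/funext => I; apply: eq_bigr => -[[x y] z] _; congr (_ * _).
rewrite /wedge3_of /wedge_of wedge3_list_det /=.
by rewrite !inordK //; case: x; case: y; case: z.
Qed.

Definition face (e : bool * bool * bool) (m : nat) : nat * nat :=
  let: (x, y, z) := (if e.1.1 then 1 else 0, if e.1.2 then 3 else 2,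
      if e.2 then 5 else 4)%N in
  nth (y, z) [:: (y, z); (x, z); (x, y)] m.

Lemma contract_split_form T (j : 'I_6) :
  Defs.contract j (split_form T) = fun J =>
    \sum_(t <- [seq (e, m) | e <- slots, m <- [:: 0; 1; 2]%N])
      (T t.1 * ((-1) ^+ t.2 * kron (nth 0%N (slot t.1) t.2) j)) *
      wedge_of (face t.1 t.2).1 (face t.1 t.2).2 J.
Proof.
apply/funext => J; rewrite big_allpairs_dep /Defs.contract /split_form.
apply: eq_bigr => -[[x y] z] _; rewrite !big_cons big_nil.
have [u [v ->]] := tuple2_eta J.
rewrite /wedge_of !wedge2_list_det.
rewrite !inordK; try by [case: x | case: y | case: z].
have -> : nat_indices [tuple of j :: [tuple u; v]] =
          [:: nat_of_ord j; nat_of_ord u; nat_of_ord v] by [].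
have -> : nat_indices [tuple u; v] = [:: nat_of_ord u; nat_of_ord v] by [].
rewrite list_det3E !list_det2E /=.
ring.
Qed.

Lemma wedge_prod_sumr (F : Type) (s : seq F) p q (d : F -> R)
  (a : tensor R p) (b : F -> tensor R q) I :
  wedge_prod a (fun J => \sum_(f <- s) d f * b f J) I =
  \sum_(f <- s) d f * wedge_prod a (b f) I.
Proof.
have -> : a = fun J => \sum_(e <- [:: tt]) 1 * a J.
  by apply/funext => J; rewrite big_seq1 mul1r.
rewrite wedge_prod_sum big_seq1; apply: eq_bigr => f _.
by rewrite mul1r; congr (_ * wedge_prod _ _ _); apply/funext => J;
    rewrite big_seq1 mul1r.
Qed.

Lemma top_wedge_list_det (i : 'I_6) k l s : (k < 6)%N -> (l < 6)%N -> size s = 3 ->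
    all (ltn^~ 6) s ->
  wedge_prod (covec R i) (wedge_prod (wedge_of k l) (wedge3_of s)) (ord_tuple 6) =
  (list_det int ([:: nat_of_ord i; k; l] ++ s) (iota 0 6))%:~R.
Proof.
move=> hk hl; case: s => [|s0 [|s1 [|s2 [|//]]]] // _ /= /and4P[h0 h1 h2 _].
have -> : wedge_prod (wedge_of k l) (wedge3_of [:: s0; s1; s2]) =
  wedge_prod (covec R (inord k))
    (wedge_prod (covec R (inord l)) (wedge3_of [:: s0; s1; s2])).
  by apply/funext => I; rewrite wedge_covecA //; exact: (@wedge_alternating _ 1 2).
have w3 (I : 3.-tuple 'I_6) : wedge3_of [:: s0; s1; s2] I =
    list_det R [:: s0; s1; s2] (nat_indices I).
  by rewrite /wedge3_of /wedge_of wedge3_list_det /= !inordK.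
have w4 (I : 4.-tuple 'I_6) :
   wedge_prod (covec R (inord l)) (wedge3_of [:: s0; s1; s2]) I =
   list_det R [:: l; s0; s1; s2] (nat_indices I).
  by rewrite (wedge_covec_list_det _ _ w3) ?inordK //;
      exact: (@wedge_alternating _ 1 2).
have w5 (I : 5.-tuple 'I_6) :
   wedge_prod (covec R (inord k))
     (wedge_prod (covec R (inord l)) (wedge3_of [:: s0; s1; s2])) I =
   list_det R [:: k; l; s0; s1; s2] (nat_indices I).
  by rewrite (wedge_covec_list_det _ _ w4) ?inordK //;
      exact: (@wedge_alternating _ 1 3).
rewrite (wedge_covec_list_det _ _ w5) ?val_ord_tuple ?val_enum_ord;
    last exact: (@wedge_alternating _ 1 4).
by rewrite list_det_int.
Qed.

End SplitForms.

(** * The endomorphism of Hitchin *)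

Section KTable.
Variable R : realType.

Lemma K_mx_split (T : bool * bool * bool -> R) (i j : 'I_6) :
  K_mx (split_form T) i j =
  - \sum_(t <- K_table i j) T t.1.1 * T t.1.2 * t.2%:~R.
Proof.
rewrite mxE contract_split_form split_formE; congr (- _).
rewrite [X in wedge_prod _ X](_ : _ = fun I =>
  \sum_(p <- [seq (t, f) | t <- [seq (e, m) | e <- slots, m <- [:: 0; 1; 2]%N],
                           f <- slots])
    (T p.1.1 * ((-1) ^+ p.1.2 * kron R (nth 0%N (slot p.1.1) p.1.2) j) * T p.2)
    * wedge_prod (wedge_of R (face p.1.1 p.1.2).1 (face p.1.1 p.1.2).2)
                 (wedge3_of R (slot p.2)) I); last first.
  by apply/funext => I; rewrite wedge_prod_sum [RHS]big_allpairs_dep.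
rewrite wedge_prod_sumr !big_allpairs_dep /= /K_table big_filter.
rewrite [RHS]big_mkcond big_allpairs_dep /=.
apply: eq_bigr => e _; rewrite exchange_big /=.
apply: eq_bigr => f _. rewrite !big_cons big_nil addr0 /=.
rewrite (_ : (if _ then _ else _) = T e * T f * (K_term i j e f)%:~R); last first.
  by case: eqP => // ->; rewrite mulr0.
case: e => -[x y] z; case: f => -[x' y'] z'.
rewrite !top_wedge_list_det; try by [case: x | case: y | case: z | case: x';
    case: y'; case: z'].
rewrite /K_term; pose L s := list_det int s (iota 0 6).
rewrite -!/(L _); move: L => L /=.
rewrite rmorphD rmorphB /= /kron.
by case: eqP => _; case: eqP => _; case: eqP => _; rewrite ?rmorph0; ring.
Qed.

End KTable.

Section Endomorphism.
Variable R : realType.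

(** The coefficients of
    a dx^135 - b dx^146 - dx^245 - dx^236 + c dx^136 + d dx^145. *)
Definition phi_slots (a b c d : R) (e : bool * bool * bool) : R :=
  match e with
  | (false, false, false) => a
  | (false, false, true) => c
  | (false, true, false) => d
  | (false, true, true) => - b
  | (true, false, true) | (true, true, false) => -1
  | _ => 0
  end.

Definition K_entry (a b c d : R) (i j : nat) : R :=
  match i, j with
  | 0, 0 => c + d | 0, 1 => - 2
  | 1, 0 => 2 * (a * b + c * d) | 1, 1 => - (c + d)
  | 2, 2 => c - d | 2, 3 => - 2 * b
  | 3, 2 => 2 * a | 3, 3 => d - c
  | 4, 4 => d - c | 4, 5 => - 2 * b
  | 5, 4 => 2 * a | 5, 5 => c - d
  | _, _ => 0
  end.

Ltac K_entry_tac :=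
  rewrite K_mx_split;
  match goal with |- context [K_table ?i ?j] =>
    let X := eval vm_compute in (K_table i j) in
    rewrite (_ : K_table i j = X); [ | by vm_compute]
  end;
  rewrite ?big_cons big_nil /=; ring.

Lemma K_mx_phi a b c d (i j : 'I_6) :
  K_mx (split_form (phi_slots a b c d)) i j = K_entry a b c d i j.
Proof.
case: i => [[|[|[|[|[|[|//]]]]]] hi]; case: j => [[|[|[|[|[|[|//]]]]]] hj].
all: K_entry_tac.
Qed.

End Endomorphism.

(** * The metric *)

Lemma det_mx22 (A : comNzRingType) (M : 'M[A]_2) :
    \det M = M 0 0 * M 1 1 - M 0 1 * M 1 0.
Proof.
rewrite (expand_det_row _ ord0)
    !big_ord_recl big_ord0 addr0 /cofactor !det_mx11 !mxE /=.
rewrite /bump /= expr0 expr1 mul1r mulN1r mulrN.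
by congr (_ * M _ _ - M _ _ * M _ _); apply: val_inj.
Qed.

Section Metric.
Variable R : realType.

Definition omega_entry (i j : nat) : R :=
  match i, j with
  | 0, 1 | 2, 3 | 4, 5 => 1
  | 1, 0 | 3, 2 | 5, 4 => -1
  | _, _ => 0
  end.

Lemma omega_mxE (i j : 'I_6) : omega_mx R i j = omega_entry i j.
Proof.
rewrite mxE /omega_form /dx2 !wedge2_list_det !ixE //.
have -> : nat_indices [tuple i; j] = [:: nat_of_ord i; nat_of_ord j] by [].
rewrite !list_det2E /kron.
case: i => [[|[|[|[|[|[|//]]]]]] hi]; case: j => [[|[|[|[|[|[|//]]]]]] hj] /=; ring.
Qed.

Lemma omega_mx_inv : invmx (omega_mx R) = - omega_mx R.
Proof.
have h : omega_mx R *m (- omega_mx R) = 1%:M.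
  apply/matrixP => i j; rewrite [LHS]mxE [RHS]mxE.
  under eq_bigr do rewrite omega_mxE mxE omega_mxE.
  rewrite !big_ord_recl big_ord0 -val_eqE.
  case: i => [[|[|[|[|[|[|//]]]]]] hi]; case: j => [[|[|[|[|[|[|//]]]]]] hj] /=; ring.
have [u _] := mulmx1_unit h.
by rewrite -[LHS]mulmx1 -h mulKmx.
Qed.

Variables a b c d : R.
Let p := split_form (phi_slots a b c d).

(** Minus the discriminant of the polynomial a X^2 + (c - d) X + b. *)
Definition disc : R := 4 * a * b - (c - d) ^+ 2.

Lemma hitchin_lambda_phi : hitchin_lambda p = - disc.
Proof.
rewrite /hitchin_lambda /mxtrace.
under eq_bigr do rewrite mxE; under eq_bigr do under eq_bigr do rewrite !K_mx_phi.
rewrite !big_ord_recl !big_ord0 /= /disc; by field.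
Qed.

Definition G_entry (i j : nat) : R :=
  match i, j with
  | 0, 0 => 2 * (a * b + c * d) | 0, 1 => - (c + d)
  | 1, 0 => - (c + d) | 1, 1 => 2
  | 2, 2 => 2 * a | 2, 3 => d - c
  | 3, 2 => d - c | 3, 3 => 2 * b
  | 4, 4 => 2 * a | 4, 5 => c - d
  | 5, 4 => c - d | 5, 5 => 2 * b
  | _, _ => 0
  end.

Definition Ginv_entry (i j : nat) : R :=
  match i, j with
  | 1, 1 => 2 * (a * b + c * d) | 0, 1 => (c + d)
  | 1, 0 => (c + d) | 0, 0 => 2
  | 3, 3 => 2 * a | 2, 3 => c - d
  | 3, 2 => c - d | 2, 2 => 2 * b
  | 5, 5 => 2 * a | 4, 5 => d - c
  | 5, 4 => d - c | 4, 4 => 2 * b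
  | _, _ => 0
  end.

Let s := Num.sqrt disc.

Lemma g_mxE (i j : 'I_6) : g_mx p i j = s^-1 * G_entry i j.
Proof.
rewrite mxE /J_mx hitchin_lambda_phi opprK -/s.
under eq_bigr do rewrite omega_mxE mxE K_mx_phi.
rewrite !big_ord_recl big_ord0.
case: i => [[|[|[|[|[|[|//]]]]]] hi]; case: j => [[|[|[|[|[|[|//]]]]]] hj] /=; ring.
Qed.

Hypothesis disc_gt0 : 0 < disc.
Let s0 : s != 0. Proof. by rewrite gt_eqF // sqrtr_gt0. Qed.
Let ss : s * s = disc. Proof. by rewrite -expr2 sqr_sqrtr // ltW. Qed.

(** Each 2 x 2 block has determinant 1, so its inverse is its adjugate. *)
Lemma g_mx_invE (i j : 'I_6) : invmx (g_mx p) i j = s^-1 * Ginv_entry i j.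
Proof.
pose N : 'M[R]_6 := \matrix_(i, j) (s^-1 * Ginv_entry i j).
suff -> : invmx (g_mx p) = N by rewrite mxE.
have h : g_mx p *m N = 1%:M.
  apply/matrixP => k l; rewrite [LHS]mxE [RHS]mxE.
  under eq_bigr do rewrite g_mxE mxE mulrACA -invfM ss.
  rewrite !big_ord_recl big_ord0 -val_eqE.
  have := disc_gt0; rewrite /disc => /lt0r_neq0 => D0.
  case: k => [[|[|[|[|[|[|//]]]]]] hi]; case: l => [[|[|[|[|[|[|//]]]]]] hj] /=;
      field => //.
have [u _] := mulmx1_unit h.
by rewrite -[LHS]mulmx1 -h mulKmx.
Qed.

Lemma det_g_mx : \det (g_mx p) = 1.
Proof.
have D0 : s^-1 * s^-1 * disc = 1 by rewrite -ss -invfM mulVf ?mulf_neq0.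
have block0 m n (M : 'M[R]_(m, n)) : (forall i j, M i j = 0) -> M = 0.
  by move=> M0; apply/matrixP => i j; rewrite M0 mxE.
rewrite -[g_mx p](@submxK _ 2 4 2 4) [dlsubmx _]block0 ?(@det_ublock _ 2 4); last first.
  move=> i j; rewrite [LHS]mxE [LHS]mxE g_mxE.
  by case: i => [[|[|[|[|//]]]] hi]; case: j => [[|[|//]] hj]; rewrite /= mulr0.
rewrite -[drsubmx _](@submxK _ 2 2 2 2) [dlsubmx _]block0 ?(@det_ublock _ 2 2);
    last first.
  move=> i j; rewrite [LHS]mxE [LHS]mxE [LHS]mxE [LHS]mxE g_mxE.
  by case: i => [[|[|//]] hi]; case: j => [[|[|//]] hj]; rewrite /= mulr0.
have ul m (M : 'M[R]_(2 + m)) i j :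
    ulsubmx M i j = M (lshift m i) (lshift m j) by rewrite [LHS]mxE mxE.
have dr m (M : 'M[R]_(2 + m)) i j :
    drsubmx M i j = M (rshift 2 i) (rshift 2 j) by rewrite [LHS]mxE mxE.
rewrite !det_mx22 !(ul 4%N) !(ul 2%N) !(dr 2%N) !(dr 4%N) !g_mxE /=.
rewrite [LHS](_ : _ = (s^-1 * s^-1 * disc) ^+ 3); last by rewrite /disc; ring.
by rewrite D0 expr1n.
Qed.

(** Multiply by C and complete the square in y. *)
Lemma quad_form_gt0 (A B C x y : R) : 0 < C -> 0 < A * C - B ^+ 2 ->
  (x != 0) || (y != 0) -> 0 < A * x ^+ 2 + 2 * B * x * y + C * y ^+ 2.
Proof.
move=> C0 D0 xy0; rewrite -(pmulr_rgt0 _ C0).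
have -> : C * (A * x ^+ 2 + 2 * B * x * y + C * y ^+ 2) =
          (A * C - B ^+ 2) * x ^+ 2 + (B * x + C * y) ^+ 2 by ring.
have [x0|x0] := eqVneq x 0; last first.
  by rewrite ltr_wpDr ?sqr_ge0 // mulr_gt0 // exprn_even_gt0.
rewrite x0 eqxx /= in xy0 *.
by rewrite expr0n /= mulr0 add0r mulr0 add0r exprn_even_gt0 //= mulf_neq0 // gt_eqF.
Qed.

Lemma g_mx_pos (v : 'rV[R]_6) : 0 < a -> 0 < b -> v != 0 ->
  0 < (v *m g_mx p *m v^T) 0 0.
Proof.
move=> a0 b0 v0.
pose x (n : nat) := v 0 (inord n).
have -> : (v *m g_mx p *m v^T) 0 0 = s^-1 * (
   ((2 * (a * b + c * d)) * x 0%N ^+ 2 + 2 * (- (c + d))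
       * x 0%N * x 1%N + 2 * x 1%N ^+ 2)
 + (2 * a * x 2 ^+ 2 + 2 * (d - c) * x 2 * x 3 + 2 * b * x 3 ^+ 2)
 + (2 * a * x 4 ^+ 2 + 2 * (c - d) * x 4 * x 5 + 2 * b * x 5 ^+ 2)).
  rewrite mxE; under eq_bigr do rewrite !mxE.
  under eq_bigr do under eq_bigr do rewrite g_mxE.
  have xE (i : 'I_6) : v 0 i = x i by rewrite /x inord_val.
  under eq_bigr do rewrite xE; under eq_bigr do under eq_bigr do rewrite xE.
  by rewrite !big_ord_recl !big_ord0 /= /bump /=; ring.
rewrite pmulr_rgt0 ?invr_gt0 ?sqrtr_gt0 //.
have nneg (A B C y z : R) : 0 < C -> 0 < A * C - B ^+ 2 ->
    0 <= A * y ^+ 2 + 2 * B * y * z + C * z ^+ 2.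
  move=> C0 D0; have [/andP[/eqP-> /eqP->]|yz] := boolP ((y == 0) && (z == 0)).
    by rewrite !expr0n /= !mulr0 !addr0.
  by apply/ltW/quad_form_gt0; rewrite // -negb_and.
have h1 : 0 < 2 * (a * b + c * d) * 2 - (- (c + d)) ^+ 2 :> R.
  by move: disc_gt0; rewrite /disc; lra.
have h2 : 0 < 2 * a * (2 * b) - (d - c) ^+ 2 by move: disc_gt0; rewrite /disc; lra.
have h3 : 0 < 2 * a * (2 * b) - (c - d) ^+ 2 by move: disc_gt0; rewrite /disc; lra.
have b2 : 0 < 2 * b by rewrite mulr_gt0.
have := nneg _ _ _ (x 0%N) (x 1%N) (ltr0Sn R 1) h1.
have := nneg _ _ _ (x 2) (x 3) b2 h2.
have := nneg _ _ _ (x 4) (x 5) b2 h3.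
have := @quad_form_gt0 _ _ _ (x 0%N) (x 1%N) (ltr0Sn R 1) h1.
have := @quad_form_gt0 _ _ _ (x 2) (x 3) b2 h2.
have := @quad_form_gt0 _ _ _ (x 4) (x 5) b2 h3.
case: (boolP ((x 0%N != 0) || (x 1%N != 0))) => [_|n0].
  by move=> _ _ /(_ isT); lra.
case: (boolP ((x 2 != 0) || (x 3 != 0))) => [_|n1].
  by move=> _ /(_ isT); lra.
case: (boolP ((x 4 != 0) || (x 5 != 0))) => [_|n2].
  by move=> /(_ isT); lra.
move: n2 n1 n0; rewrite !negb_or !negbK => /andP[/eqP x4 /eqP x5] /andP[/eqP x2
    /eqP x3] /andP[/eqP x0 /eqP x1].
case/negP: v0; apply/eqP/matrixP => i j; rewrite ord1 mxE -[j]inord_val.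
rewrite -/(x _); case: j => [[|[|[|[|[|[|//]]]]]] hj] //.
Qed.

End Metric.

(** * Norm and Hodge star *)

Section TupleSums.
Variable R : realType.

Lemma sum_tuple3 (F : 3.-tuple 'I_6 -> R) :
  \sum_(L : 3.-tuple 'I_6) F L = \sum_x \sum_y \sum_z F [tuple x; y; z].
Proof.
rewrite pair_bigA pair_bigA /=.
rewrite (reindex (fun t : 'I_6 * 'I_6 * 'I_6 => [tuple t.1.1; t.1.2; t.2])) //.
exists (fun L : 3.-tuple 'I_6 => (tnth L 0, tnth L 1, tnth L (inord 2))).
  by move=> -[[x y] z] _; rewrite !(tnth_nth ord0) /= inordK.
move=> L _; have [x [y [z ->]]] := tuple3_eta L.
by rewrite !(tnth_nth ord0) /= inordK.
Qed.

Lemma sum_kron (F : 'I_6 -> R) n : (n < 6)%N ->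
  \sum_(x < 6) kron R n x * F x = F (inord n).
Proof.
move=> n6; rewrite (bigD1 (inord n)) //= big1 ?addr0 => [|x].
  by rewrite /kron inordK // eqxx mul1r.
by rewrite -val_eqE /= inordK // eq_sym /kron => /negPf ->; rewrite mul0r.
Qed.

(** Only the six arrangements of (i, j, k) contribute. *)
Lemma sum_list_det3 (F : 3.-tuple 'I_6 -> R) i j k :
  (i < 6)%N -> (j < 6)%N -> (k < 6)%N ->
  \sum_(L : 3.-tuple 'I_6) list_det R [:: i; j; k] (nat_indices L) * F L =
    F [tuple inord i; inord j; inord k] - F [tuple inord i; inord k; inord j]
  - F [tuple inord j; inord i; inord k] + F [tuple inord k; inord i; inord j]
  + F [tuple inord j; inord k; inord i] - F [tuple inord k; inord j; inord i].
Proof.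
move=> hi hj hk; rewrite sum_tuple3.
have E (x y z : 'I_6) :
    list_det R [:: i; j; k] (nat_indices [tuple x; y; z]) * F [tuple x; y; z] =
    kron R i x * (kron R j y * (kron R k z * F [tuple x; y; z]))
  - kron R i x * (kron R k y * (kron R j z * F [tuple x; y; z]))
  - kron R j x * (kron R i y * (kron R k z * F [tuple x; y; z]))
  + kron R k x * (kron R i y * (kron R j z * F [tuple x; y; z]))
  + kron R j x * (kron R k y * (kron R i z * F [tuple x; y; z]))
  - kron R k x * (kron R j y * (kron R i z * F [tuple x; y; z])).
  by rewrite [nat_indices _]/= list_det3E; ring.
under eq_bigr do under eq_bigr do under eq_bigr do rewrite E.
have S l m n : (l < 6)%N -> (m < 6)%N -> (n < 6)%N ->
   \sum_(x < 6) \sum_(y < 6) \sum_(z < 6)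
       kron R l x * (kron R m y * (kron R n z * F [tuple x; y; z])) =
   F [tuple inord l; inord m; inord n].
  move=> hl hm hn.
  under eq_bigr do under eq_bigr do rewrite -!big_distrr /= sum_kron //.
  under eq_bigr do rewrite -big_distrr /= (sum_kron (fun y => F [tuple _; y; _])) //.
  by rewrite (sum_kron (fun y => F [tuple y; _; _])).
do 3 under eq_bigr do [under eq_bigr do rewrite ?(big_split, sumrN) /=;
    rewrite ?(big_split, sumrN) /=].
rewrite ?(big_split, sumrN) /= !S //.
Qed.

End TupleSums.

Section HodgeStar.
Variable R : realType.

Lemma slots_sum (F : bool * bool * bool -> R) : \sum_(e <- slots) F e =
  F (false, false, false) + F (false, false, true) + F (false, true, false)
  + F (false, true, true) + F (true, false, false) + F (true, false, true)
  + F (true, true, false) + F (true, true, true).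
Proof. by rewrite /slots !big_cons big_nil; ring. Qed.

Lemma slot_lt6 e : [/\ (nth 0 (slot e) 0 < 6)%N,
    (nth 0 (slot e) 1 < 6)%N & (nth 0 (slot e) 2 < 6)%N].
Proof. by case: e => -[x y] z; split; case: x; case: y; case: z. Qed.

Lemma sum_split_form T (F : 3.-tuple 'I_6 -> R) :
  \sum_(L : 3.-tuple 'I_6) split_form T L * F L =
  \sum_(e <- slots) T e *
    \sum_(L : 3.-tuple 'I_6) list_det R (slot e) (nat_indices L) * F L.
Proof.
under eq_bigr do rewrite /split_form big_distrl /=.
rewrite exchange_big /=; apply: eq_bigr => e _.
by rewrite big_distrr /=; apply: eq_bigr => L _; rewrite mulrA.
Qed.

Lemma split_form_inner (T U : bool * bool * bool -> R) :
  \sum_(L : 3.-tuple 'I_6) split_form T L * split_form U L =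
  6 * \sum_(e <- slots) T e * U e.
Proof.
rewrite sum_split_form big_distrr /=; apply: eq_bigr => e _.
rewrite mulrCA; congr (_ * _).
case: e => -[x y] z; have [h0 h1 h2] := slot_lt6 (x, y, z).
rewrite (sum_list_det3 _ h0 h1 h2) /split_form.
have N u v w : nat_indices [tuple u; v; w] =
    [:: nat_of_ord u; nat_of_ord v; nat_of_ord w] by [].
rewrite !slots_sum !N !list_det3E.
clear h0 h1 h2.
by case: x; case: y; case: z; rewrite /= !inordK // /kron /=; ring.
Qed.

Definition raised_slots (a b c d : R) (e : bool * bool * bool) : R :=
  match e with
  | (true, true, true) => - a * (c + d)
  | (true, true, false) => c ^+ 2 - c * d - 2 * a * b
  | (true, false, true) => d ^+ 2 - c * d - 2 * a * b
  | (true, false, false) => b * (c + d)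
  | (false, true, true) => - 2 * a
  | (false, true, false) => c - d
  | (false, false, true) => d - c
  | (false, false, false) => 2 * b
  end.

Definition star_slots (a b c d : R) (e : bool * bool * bool) : R :=
  match e with
  | (false, false, false) => - a * (c + d)
  | (false, false, true) => 2 * a * b + c * d - c ^+ 2
  | (false, true, false) => 2 * a * b + c * d - d ^+ 2
  | (false, true, true) => b * (c + d)
  | (true, false, false) => 2 * a
  | (true, false, true) => c - d
  | (true, true, false) => d - c
  | (true, true, true) => - 2 * b
  end.

Lemma kron_sym x y : kron R x y = kron R y x.
Proof. by rewrite /kron eq_sym. Qed.

(** Only the complementary triple completes e to a permutation of the six
    indices: the Hodge star exchanges the two indices of each pair. *)
Lemma slot_levi_civita e (J : 3.-tuple 'I_6) :
  \sum_(L : 3.-tuple 'I_6) list_det R (slot e) (nat_indices L) *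
    levi_civita R (L ++ J) =
  6 * ((-1) ^+ (~~ e.1.1 + ~~ e.1.2 + ~~ e.2) *
       list_det R (slot (~~ e.1.1, ~~ e.1.2, ~~ e.2)) (nat_indices J)).
Proof.
have [u [v [w ->]]] := tuple3_eta J.
have N (x y z : 'I_6) : nat_indices [tuple x; y; z] =
  [:: nat_of_ord x; nat_of_ord y; nat_of_ord z] by [].
have lc i j k : (i < 6)%N -> (j < 6)%N -> (k < 6)%N ->
  levi_civita R ([tuple inord i; inord j; inord k] ++ [tuple u; v; w]) =
  list_det R [:: i; j; k; nat_of_ord u; nat_of_ord v; nat_of_ord w] (iota 0 6).
  by move=> *; rewrite levi_civitaE //; congr list_det; rewrite /= !inordK.
case: e => -[x y] z; case: x; case: y; case: z.
all: rewrite /slot; cbn [fst snd negb]; rewrite sum_list_det3 // !lc // N list_det3E.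
all: rewrite /= !(kron_sym _ u) !(kron_sym _ v) !(kron_sym _ w).
all: (rewrite /= ?if_kron; ring).
Qed.

Variables a b c d : R.
Let p := split_form (phi_slots a b c d).
Let s := Num.sqrt (disc a b c d).
Hypothesis disc_gt0 : 0 < disc a b c d.

(** Raising three indices produces s^-3 times a polynomial that happens to be a
    multiple of the discriminant s^2, leaving a single factor s^-1. *)
Lemma raise_phi I : raise_indices (g_mx p) p I =
    s^-1 * split_form (raised_slots a b c d) I.
Proof.
have s0 : s != 0 by rewrite gt_eqF // sqrtr_gt0.
have s3 : s^-1 * s^-1 * s^-1 * disc a b c d = s^-1.
  by rewrite -[disc _ _ _ _]sqr_sqrtr ?ltW // -/s; field.
rewrite /raise_indices.
under eq_bigr do rewrite mulrC.
rewrite sum_split_form.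
have [x [y [z ->]]] := tuple3_eta I.
pose G (m n : nat) := Ginv_entry a b c d m n.
have P i j k : (i < 6)%N -> (j < 6)%N -> (k < 6)%N ->
   \prod_(m < 3) invmx (g_mx p) (tnth [tuple x; y; z] m)
                   (tnth [tuple inord i; inord j; inord k] m) =
   s^-1 * s^-1 * s^-1 * (G x i * G y j * G z k).
  move=> hi hj hk; rewrite !big_ord_recl big_ord0 mulr1 !(g_mx_invE disc_gt0).
  by rewrite !(tnth_nth ord0) /= !inordK // /G /s; ring.
rewrite slots_sum !sum_list_det3 // !P //=.
have Gd (m : 'I_6) :
  [/\ G m 0%N = 2 * kron R 0 m + (c + d) * kron R 1 m,
      G m 1%N = (c + d) * kron R 0 m + 2 * (a * b + c * d) * kron R 1 m &
  [/\ G m 2%N = 2 * b * kron R 2 m + (c - d) * kron R 3 m,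
      G m 3%N = (c - d) * kron R 2 m + 2 * a * kron R 3 m,
      G m 4%N = 2 * b * kron R 4 m + (d - c) * kron R 5 m &
      G m 5%N = (d - c) * kron R 4 m + 2 * a * kron R 5 m]].
  rewrite /G /kron; case: m => [[|[|[|[|[|[|//]]]]]] hm] /=;
    (split; [ring|ring|split; ring]).
have [x0 x1 [x2 x3 x4 x5]] := Gd x.
have [y0 y1 [y2 y3 y4 y5]] := Gd y.
have [z0 z1 [z2 z3 z4 z5]] := Gd z.
rewrite !(x0, x1, x2, x3, x4, x5, y0, y1, y2, y3, y4, y5, z0, z1, z2, z3, z4, z5).
rewrite -[in RHS]s3 /split_form slots_sum.
have N u v w : nat_indices [tuple u; v; w] =
    [:: nat_of_ord u; nat_of_ord v; nat_of_ord w] by [].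
rewrite !N !list_det3E /disc /=.
generalize (s^-1 * s^-1 * s^-1) => r.
ring.
Qed.

Lemma norm_sq_phi : norm_sq (g_mx p) p = 2 * s.
Proof.
rewrite /norm_sq; under eq_bigr do rewrite raise_phi mulrCA.
rewrite -big_distrr /= split_form_inner slots_sum /=.
have ss : s * s = disc a b c d by rewrite -expr2 sqr_sqrtr // ltW.
have s0 : s != 0 by rewrite gt_eqF // sqrtr_gt0.
apply: (mulfI s0); rewrite [RHS]mulrCA ss /disc.
by rewrite (_ : 3`! = 6)%N //; field.
Qed.

Lemma hodge_phi (J : 3.-tuple 'I_6) :
  (hodge (g_mx p) p : tensor R 3) J = s^-1 * split_form (star_slots a b c d) J.
Proof.
rewrite /hodge det_g_mx // sqrtr1 mulr1.
under eq_bigr do rewrite raise_phi -mulrA.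
rewrite -big_distrr /= mulrCA; congr (_ * _).
rewrite sum_split_form.
have [u [v [w ->]]] := tuple3_eta J.
under eq_bigr do rewrite slot_levi_civita.
rewrite /split_form !slots_sum /=.
rewrite (_ : 3`! = 6)%N //; by field.
Qed.

End HodgeStar.

(** * Gaussian integrals *)

Section Gauss.
Variable R : realType.
Notation mu := (@lebesgue_measure R).

Definition gauss_kernel (z : R) : R := (Num.sqrt pi)^-1 * expR (- z ^+ 2).

(** A single integrable bound for the kernel and for z times the kernel, the
    two weights that occur when averages are differentiated. *)
Definition gauss_dom (z : R) : R := (Num.sqrt pi)^-1 * expR (- (z ^+ 2 / 2)).

Lemma sqrt_pi_gt0 : 0 < Num.sqrt pi :> R.
Proof. by rewrite sqrtr_gt0 pi_gt0. Qed.

Lemma gauss_kernel_ge0 z : 0 <= gauss_kernel z.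
Proof. by rewrite mulr_ge0 ?expR_ge0 // invr_ge0 sqrtr_ge0. Qed.

Lemma gauss_dom_ge0 z : 0 <= gauss_dom z.
Proof. by rewrite mulr_ge0 ?expR_ge0 // invr_ge0 sqrtr_ge0. Qed.

Lemma gauss_kernel_le z : gauss_kernel z <= gauss_dom z.
Proof.
rewrite ler_wpM2l ?invr_ge0 ?sqrtr_ge0 // ler_expR lerN2.
by rewrite ler_pdivrMr // ler_peMr ?sqr_ge0 // ler1n.
Qed.

(** The factor |z| is absorbed by half of the exponent, as
    |z| <= 1 + z^2 / 2 <= exp (z^2 / 2). *)
Lemma abs_mul_gauss_kernel_le z : `|z * gauss_kernel z| <= gauss_dom z.
Proof.
rewrite normrM (ger0_norm (gauss_kernel_ge0 z)) /gauss_kernel /gauss_dom mulrCA.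
rewrite ler_wpM2l ?invr_ge0 ?sqrtr_ge0 //.
have -> : - z ^+ 2 = - (z ^+ 2 / 2) - z ^+ 2 / 2 by field.
rewrite expRD mulrCA -[leRHS]mulr1 ler_wpM2l ?expR_ge0 //.
rewrite expRN -(@ler_pM2r _ (expR (z ^+ 2 / 2))) ?expR_gt0 //.
rewrite mulfVK ?gt_eqF ?expR_gt0 // mul1r.
apply: le_trans (expR_ge1Dx _).
have : 0 <= (`|z| - 1) ^+ 2 by exact: sqr_ge0.
rewrite -[z ^+ 2]real_normK ?num_real //; lra.
Qed.

Lemma is_derive_gauss_kernel (z : R) :
    is_derive z 1 gauss_kernel (- (2 * (z * gauss_kernel z))).
Proof.
rewrite /gauss_kernel.
have -> : (fun z : R => (Num.sqrt pi)^-1 * expR (- z ^+ 2)) =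
  (Num.sqrt pi)^-1 *: (expR \o (fun z => - z ^+ 2)) by [].
apply: is_derive_eq.
rewrite /GRing.scale /= ; ring.
Qed.

Lemma continuous_gauss_kernel : continuous gauss_kernel.
Proof.
move=> z; apply: differentiable_continuous; apply/derivable1_diffP.
by case: (is_derive_gauss_kernel z).
Qed.

Lemma integrable_gauss_dom : mu.-integrable setT (EFin \o gauss_dom).
Proof.
have h := @integrable_normal_pdf R 0 1.
have -> : EFin \o gauss_dom = (fun x =>
    (((Num.sqrt pi)^-1 * (normal_peak (1:R))^-1)%:E * (normal_pdf 0 1 x)%:E)%E).
  apply/funext => x /=; rewrite normal_pdfE ?oner_neq0 //= -EFinM; congr (_%:E).
  rewrite -!mulrA mulKf ?gt_eqF ?normal_peak_gt0 ?oner_neq0 //.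
  by rewrite /gauss_dom /normal_fun subr0 expr1n mulNr.
exact: integrableZl.
Qed.

Lemma integral_gauss_kernel : \int[mu]_z gauss_kernel z = 1.
Proof.
rewrite /Rintegral /gauss_kernel.
under eq_integral do rewrite EFinM.
rewrite integralZl //; last exact: integrableT_gauss.
by rewrite integralT_gauss -EFinM /= mulVf // gt_eqF // sqrt_pi_gt0.
Qed.

Lemma integrable_dom (h : R -> R) C : continuous h ->
  (forall z, `|h z| <= C * gauss_dom z) -> mu.-integrable setT (EFin \o h).
Proof.
move=> ch hC.
apply: (@le_integrable _ _ _ mu setT _ _ (fun z => (C%:E * (gauss_dom z)%:E)%E)) => //.
- apply/measurable_EFinP; exact: continuous_measurable_fun.
- by move=> z _ /=; rewrite lee_fin (le_trans (hC z)) // ler_norm.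
- by apply: integrableZl => //; exact: integrable_gauss_dom.
Qed.

(** On [-n, n] the integral is a difference of boundary values, which the
    Gaussian bound on the primitive sends to 0. *)
Lemma integral_derivative_eq0 (H h : R -> R) C D : continuous h ->
  (forall z : R, is_derive z 1 H (h z)) ->
  (forall z, `|h z| <= C * gauss_dom z) -> (forall z, `|H z| <= D * gauss_dom z) ->
  \int[mu]_z h z = 0.
Proof.
move=> ch dH hC HD.
have cH : continuous H.
  by move=> z; apply/differentiable_continuous/derivable1_diffP; case: (dH z).
have ih := integrable_dom ch hC.
pose hn n : R -> R := h \_ `[- n%:R, n%:R].
have lim1 : (\int[mu]_z (hn n z)%:E)%E @[n --> \oo] --> (\int[mu]_z (h z)%:E)%E.
  apply: (@dominated_cvg _ _ _ mu setT measurableT _ _ (fun z => (`|h z|)%:E)) => //.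
  - move=> n; apply/measurable_EFinP.
    apply: (measurable_restrictT h (measurable_itv `[- n%:R, n%:R])).1.
    by apply: measurable_funTS; exact: continuous_measurable_fun.
  - move=> z _; apply: cvg_near_cst.
    have [N _ zN] := nbhs_infty_ger `|z|.
    exists N => // n /= Nn; rewrite /hn patchE ifT // inE /= in_itv /=.
    by rewrite -ler_norml; exact: zN.
  - exact: integrable_norm.
  - move=> n z _; rewrite lee_fin /hn patchE; case: ifP => //.
    by rewrite normr0.
have FTC n : (\int[mu]_z (hn n.+1 z)%:E)%E = (H n.+1%:R - H (- n.+1%:R))%:E.
  rewrite EFinB -(@continuous_FTC2 _ h H).
  - by rewrite [RHS]integral_mkcond; apply: eq_integral => z _; rewrite restrict_EFin.
  - by rewrite -subr_gt0 opprK addr_gt0 // ltr0Sn.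
  - exact: continuous_subspaceT.
  - split.
    + by move=> z _; case: (dH z).
    + by apply: cvg_at_right_filter; exact: cH.
    + by apply: cvg_at_left_filter; exact: cH.
  - by move=> z _; rewrite derive1E; case: (dH z).
have lim2 : (\int[mu]_z (hn n.+1 z)%:E)%E @[n --> \oo] --> 0%E.
  rewrite (_ : (fun n => _) = (fun n => (H n.+1%:R - H (- n.+1%:R))%:E)); last first.
    by apply/funext => n; exact: FTC.
  apply: cvg_EFin; first exact: nearW.
  have gd n (z : R) : z ^+ 2 = n.+1%:R ^+ 2 ->
      `|H z| <= `|D| * (Num.sqrt pi)^-1 * 2 * n.+1%:R^-1.
    move=> zn; apply: (le_trans (HD z)).
    apply: (@le_trans _ _ (`|D| * gauss_dom z)).
      by rewrite ler_wpM2r ?gauss_dom_ge0 // ler_norm.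
    rewrite -!mulrA ler_wpM2l // ler_wpM2l ?invr_ge0 ?sqrtr_ge0 //.
    rewrite expRN -[X in _ <= X]invf_div lef_pV2 ?posrE ?expR_gt0 ?divr_gt0 //.
    apply: le_trans (expR_ge1Dx _); rewrite zn.
    have := sqr_ge0 (n.+1%:R - 1 : R); have := sqr_ge0 (n.+1%:R : R).
    by move: (n.+1%:R : R) => N; rewrite !expr2; lra.
  apply: (@squeeze_cvgr _ _ _ _
    (fun n => - ((`|D| * (Num.sqrt pi)^-1 * 2 * 2) * n.+1%:R^-1))
    (fun n => (`|D| * (Num.sqrt pi)^-1 * 2 * 2) * n.+1%:R^-1)).
  - apply: nearW => n; rewrite -ler_norml (le_trans (ler_normB _ _)) //.
    rewrite [leRHS](_ : _ = `|D| * (Num.sqrt pi)^-1 * 2 * n.+1%:R^-1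
                          + `|D| * (Num.sqrt pi)^-1 * 2 * n.+1%:R^-1); last by ring.
    by rewrite lerD ?gd ?sqrrN.
  - rewrite -[X in _ --> X]oppr0; apply: cvgN.
    rewrite -[X in _ --> X](mulr0 (`|D| / Num.sqrt pi * 2 * 2)).
    by apply: cvgMr; exact: cvg_harmonic.
  - rewrite -[X in _ --> X](mulr0 (`|D| / Num.sqrt pi * 2 * 2)).
    by apply: cvgMr; exact: cvg_harmonic.
rewrite /Rintegral.
have lim1' : (\int[mu]_z (hn n.+1 z)%:E)%E @[n --> \oo] --> (\int[mu]_z (h z)%:E)%E.
  by have := lim1; rewrite -(cvg_shiftS (fun n => \int[mu]_z (hn n z)%:E)%E).
by rewrite (cvg_unique _ lim1' lim2).
Qed.

End Gauss.

(** * Gaussian averages of bounded functions *)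

Section HeatOp.
Variable R : realType.
Notation mu := (@lebesgue_measure R).
Implicit Types (f g : R -> R) (x s z : R).

Lemma is_derive_param_integral (g g' : R -> R -> R) (l0 : R) C C' :
  (forall l, continuous (g l)) -> (forall l z, `|g l z| <= C * gauss_dom z) ->
  (forall l z : R, is_derive l 1 (g^~ z) (g' l z)) ->
  (forall l z, `|g' l z| <= C' * gauss_dom z) ->
  is_derive l0 1 (fun l => \int[mu]_z g l z) (\int[mu]_z g' l0 z).
Proof.
move=> cg gC dg g'C.
have I0 : `]l0 - 1, l0 + 1[%classic l0.
  by rewrite /= in_itv /= ltrBlDr ltrDl ltr01.
have ig l : `]l0 - 1, l0 + 1[%classic l -> mu.-integrable setT (EFin \o g l).
  by move=> _; exact: integrable_dom (cg l) (gC l).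
have dg' l z : `]l0 - 1, l0 + 1[%classic l -> setT z -> derivable (g^~ z) l 1.
  by move=> _ _; case: (dg l z).
have p1 l z : partial1of2 g l z = g' l z.
  by rewrite partial1of2E; case: (dg l z).
have G0 (z : R) : 0 <= `|C'| * gauss_dom z by rewrite mulr_ge0 ?gauss_dom_ge0.
have iG : mu.-integrable setT (EFin \o (fun z => `|C'| * gauss_dom z)).
  by have := integrableZl measurableT `|C'| (@integrable_gauss_dom R); exact.
have Gub l z : `]l0 - 1, l0 + 1[%classic l -> setT z ->
    `|partial1of2 g l z| <= `|C'| * gauss_dom z.
  move=> _ _; rewrite p1 (le_trans (g'C l z)) //.
  by rewrite ler_wpM2r ?gauss_dom_ge0 // ler_norm.
apply: DeriveDef.
  exact: (derivable_under_integral measurableT I0 ig dg' G0 iG Gub).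
rewrite -derive1E (differentiation_under_integral measurableT I0 ig dg' G0 iG Gub).
by apply: eq_Rintegral => z _; rewrite p1.
Qed.

(** The expectation of f (x + s Z) for a centred normal Z of variance 1/2. *)
Definition heat_avg (s : R) f (x : R) : R :=
    \int[mu]_z (f (x + s * z) * gauss_kernel z).

Definition bounded_by f (M : R) := forall x, `|f x| <= M.

Lemma continuous_affine f x s : continuous f -> continuous (fun z : R => f (x + s * z)).
Proof.
move=> cf z; apply: (@continuous_comp _ _ _ (fun z : R => x + s * z) f); last exact: cf.
apply: cvgD; first exact: cvg_cst.
by apply: cvgM; [exact: cvg_cst|exact: cvg_id].
Qed.

Lemma avg_continuous f x s : continuous f ->
    continuous (fun z : R => f (x + s * z) * gauss_kernel z).
Proof.
move=> cf z; apply: cvgM; first exact: (@continuous_affine f x s cf).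
exact: continuous_gauss_kernel.
Qed.

Lemma avg_dom f M x s z : bounded_by f M ->
    `|f (x + s * z) * gauss_kernel z| <= M * gauss_dom z.
Proof.
move=> fM; rewrite normrM ler_pM // ger0_norm ?gauss_kernel_ge0 //;
    exact: gauss_kernel_le.
Qed.

Lemma avgz_continuous f x s : continuous f ->
  continuous (fun z : R => f (x + s * z) * (z * gauss_kernel z)).
Proof.
move=> cf z; apply: cvgM; first exact: (@continuous_affine f x s cf).
by apply: cvgM; [exact: cvg_id|exact: continuous_gauss_kernel].
Qed.

Lemma avgz_dom f M x s z : bounded_by f M ->
  `|f (x + s * z) * (z * gauss_kernel z)| <= M * gauss_dom z.
Proof. move=> fM; rewrite normrM ler_pM //; exact: abs_mul_gauss_kernel_le. Qed.

Lemma avg_integrable f M x s : continuous f -> bounded_by f M ->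
  mu.-integrable setT (EFin \o (fun z => f (x + s * z) * gauss_kernel z)).
Proof.
move=> cf fM; apply: (@integrable_dom _ _ M); first exact: avg_continuous.
by move=> z; exact: avg_dom.
Qed.

Lemma heat_avg_lin a b f g Mf Mg s x : continuous f -> bounded_by f Mf ->
  continuous g -> bounded_by g Mg ->
  heat_avg s (fun y => a * f y + b * g y) x = a * heat_avg s f x + b * heat_avg s g x.
Proof.
move=> cf fM cg gM; rewrite /heat_avg.
have i1 := avg_integrable x s cf fM; have i2 := avg_integrable x s cg gM.
rewrite -!RintegralZl // -RintegralD //.
- by apply: eq_Rintegral => z _; ring.
- by have := integrableZl measurableT a i1; exact.
- by have := integrableZl measurableT b i2; exact.
Qed.

Lemma heat_avg_cst c s x : heat_avg s (fun=> c) x = c.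
Proof.
rewrite /heat_avg RintegralZl // ?integral_gauss_kernel ?mulr1 //.
apply: (@integrable_dom _ _ 1); first exact: continuous_gauss_kernel.
by move=> z; rewrite mul1r ger0_norm ?gauss_kernel_ge0 ?gauss_kernel_le.
Qed.

Lemma heat_avg_ge c f M s x : continuous f -> bounded_by f M ->
  (forall y, c <= f y) -> c <= heat_avg s f x.
Proof.
move=> cf fM cf'; rewrite -[leLHS](heat_avg_cst c s x).
apply: le_Rintegral => //.
- by apply: (@avg_integrable (fun=> c) `|c|) => //; exact: cst_continuous.
- exact: avg_integrable cf fM.
- by move=> z _; rewrite ler_wpM2r ?gauss_kernel_ge0.
Qed.

Lemma heat_avg0 f x : heat_avg 0 f x = f x.
Proof.
rewrite -[RHS](heat_avg_cst (f x) 0 x).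
by apply: eq_Rintegral => z _; rewrite mul0r addr0.
Qed.

Lemma heat_avg_period f s x : (forall y, f (y + 1) = f y) ->
  heat_avg s f (x + 1) = heat_avg s f x.
Proof. by move=> fp; apply: eq_Rintegral => z _; rewrite addrAC fp. Qed.

Lemma is_derive_shift f (df : R) x s z : is_derive (x + s * z) 1 f df ->
  is_derive x 1 (fun x => f (x + s * z)) df.
Proof.
move=> h; have h2 : is_derive x 1 (fun x : R => x + s * z) (1 + 0).
  exact: is_deriveD.
by have := @is_derive1_comp _ f (fun x => x + s * z) x _ _ h h2; rewrite addr0 mulr1.
Qed.

Lemma is_derive_scale f (df : R) x s z : is_derive (x + s * z) 1 f df ->
  is_derive s 1 (fun s => f (x + s * z)) (df * z).
Proof.
move=> h; have h2 : is_derive s 1 (fun s : R => x + s * z) (0 + z).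
  apply: is_deriveD; rewrite [X in is_derive _ _ X](_ : _ = z \*: id); last first.
    by apply/funext => u; rewrite /GRing.scale /= mulrC.
  by apply: is_derive_eq; rewrite /GRing.scale /= mulr1.
by have := @is_derive1_comp _ f (fun s => x + s * z) s _ _ h h2; rewrite add0r.
Qed.

Lemma is_derive_mulr (h : R -> R) (x k dh : R) :
  is_derive x 1 h dh -> is_derive x 1 (fun y => h y * k) (dh * k).
Proof.
move=> d; rewrite [X in is_derive _ _ X](_ : _ = k \*: h); last first.
  by apply/funext => u; rewrite /GRing.scale /= mulrC.
by rewrite mulrC; exact: is_deriveZ.
Qed.

Section Derive.
Variables (f f' : R -> R) (M M' : R).
Hypotheses (cf : continuous f) (fM : bounded_by f M).
Hypotheses (cf' : continuous f') (f'M : bounded_by f' M').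
Hypothesis df : forall x : R, is_derive x 1 f (f' x).

Lemma heat_avg_dx s (x : R) : is_derive x 1 (heat_avg s f) (heat_avg s f' x).
Proof.
apply: (@is_derive_param_integral (fun x z => f (x + s * z) * gauss_kernel z)
  (fun x z => f' (x + s * z) * gauss_kernel z) x M M').
- by move=> l; exact: avg_continuous.
- by move=> l z; exact: avg_dom.
- by move=> l z; apply/is_derive_mulr/is_derive_shift.
- by move=> l z; exact: avg_dom.
Qed.

Lemma heat_avg_ds (s : R) x : is_derive s 1 (fun s => heat_avg s f x)
  (\int[mu]_z (f' (x + s * z) * (z * gauss_kernel z))).
Proof.
apply: (@is_derive_param_integral (fun s z => f (x + s * z) * gauss_kernel z)
  (fun s z => f' (x + s * z) * (z * gauss_kernel z)) s M M').
- by move=> l; exact: avg_continuous.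
- by move=> l z; exact: avg_dom.
- by move=> l z; rewrite mulrA; apply/is_derive_mulr/is_derive_scale.
- by move=> l z; exact: avgz_dom.
Qed.

(** The function z |-> f (x + s z) exp (- z^2) has a derivative of zero
    integral, and exp (- z^2) has derivative - 2 z exp (- z^2). *)
Lemma heat_avg_stein s x :
  2 * \int[mu]_z (f (x + s * z) * (z * gauss_kernel z)) = s * heat_avg s f' x.
Proof.
have i1 := avg_integrable x s cf' f'M.
have i2 : mu.-integrable setT (EFin \o (fun z => f (x + s * z) * (z * gauss_kernel z))).
  apply: (@integrable_dom _ _ M); first exact: avgz_continuous.
  by move=> z; exact: avgz_dom.
pose h z := s * (f' (x + s * z) * gauss_kernel z) -
            2 * (f (x + s * z) * (z * gauss_kernel z)).
have h0 : \int[mu]_z h z = 0.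
  apply: (@integral_derivative_eq0 R (fun z => f (x + s * z) * gauss_kernel z)
      h (`|s| * M' + 2 * M) M).
  - move=> z; apply: cvgB; apply: cvgM; try exact: cvg_cst.
      exact: avg_continuous.
    exact: avgz_continuous.
  - move=> z.
    have h2 : is_derive z 1 (fun z : R => x + s * z) (0 + s).
      apply: is_deriveD; rewrite [X in is_derive _ _ X](_ : _ = s \*: id) //.
      by apply: is_derive_eq; rewrite /GRing.scale /= mulr1.
    have d1 := @is_derive1_comp _ f (fun z : R => x + s * z) z _ _ (df _) h2.
    have dd := is_deriveM d1 (is_derive_gauss_kernel z).
    suff -> : h z = (f \o (fun z : R => x + s * z)) z *: (- (2 * (z * gauss_kernel z)))
                    + gauss_kernel z *: (f' (x + s * z) * (0 + s)) by exact: dd.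
    by rewrite /h /GRing.scale /=; ring.
  - move=> z; apply: (le_trans (ler_normB _ _)); rewrite [leRHS]mulrDl.
    apply: lerD.
      by rewrite normrM -mulrA ler_wpM2l // avg_dom.
    by rewrite normrM -mulrA ger0_norm // ler_wpM2l // avgz_dom.
  - by move=> z; exact: avg_dom.
move/eqP: h0; rewrite /h RintegralB //.
- by rewrite !RintegralZl // subr_eq0 => /eqP.
- by have := integrableZl measurableT s i1; exact.
- by have := integrableZl measurableT 2 i2; exact.
Qed.

Definition dom_mass : R := \int[mu]_z gauss_dom z.

Lemma dom_mass_ge0 : 0 <= dom_mass.
Proof. by apply: Rintegral_ge0 => z _; exact: gauss_dom_ge0. Qed.

Lemma norm_integral_le_dom (h : R -> R) C : continuous h ->
    (forall z, `|h z| <= C * gauss_dom z) ->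
  `|\int[mu]_z h z| <= C * dom_mass.
Proof.
move=> ch hC; have ih := integrable_dom ch hC.
apply: (le_trans (le_normr_Rintegral _ ih)) => //.
rewrite /dom_mass -RintegralZl //; last exact: integrable_gauss_dom.
apply: le_Rintegral => //; first exact: integrable_norm.
by have := integrableZl measurableT C (@integrable_gauss_dom R); exact.
Qed.

(** The identity of [heat_avg_stein] moves the derivative from f to the kernel
    at the price of 1/s; since s grows with time, this yields the long time
    decay. *)
Lemma heat_avg_decay s x : 0 < s -> `|heat_avg s f' x| <= 2 * M * dom_mass / s.
Proof.
move=> s0; rewrite ler_pdivlMr // -[X in _ * X](gtr0_norm s0) -normrM mulrC.
rewrite -heat_avg_stein normrM ger0_norm // -mulrA ler_wpM2l //.
apply: norm_integral_le_dom; first exact: avgz_continuous.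
by move=> z; exact: avgz_dom.
Qed.

End Derive.

End HeatOp.

(** * Smooth functions on the circle *)

Section Smooth.
Variable R : realType.
Implicit Types (f g : R -> R) (x s z : R).

(** Differentiability n times, in a form that goes through products and
    compositions by induction on n. *)
Fixpoint nderiv n f : Prop :=
  if n is n'.+1 then
    exists2 f' : R -> R, (forall x, is_derive x 1 f (f' x)) & nderiv n' f'
  else True.

Lemma is_derive_derive1 f x : derivable f x 1 -> is_derive x 1 f (derive1 f x).
Proof. by move=> df; apply: DeriveDef => //; rewrite derive1E. Qed.

Lemma is_derive_eq_derive1 f f' : (forall x, is_derive x 1 f (f' x)) -> derive1 f = f'.
Proof. by move=> h; apply/funext => x; rewrite derive1E; case: (h x). Qed.

Lemma nderivP f : (forall n, nderiv n f) <-> (forall n x, derivable (derive1n n f) x 1).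
Proof.
split=> [h n|h n].
  elim: n f h => [|n IHn] f h x; first by have [f' df _] := h 1; case: (df x).
  rewrite derive1Sn; apply: IHn => m; have [f' df hf'] := h m.+1.
  by rewrite (is_derive_eq_derive1 df).
elim: n f h => [//|n IHn] f h; exists (derive1 f) => [x|].
  exact/is_derive_derive1/(h 0).
by apply: IHn => m x; rewrite -derive1Sn.
Qed.

Lemma nderivW n f : nderiv n.+1 f -> nderiv n f.
Proof.
elim: n f => [//|n IHn] f [f' df hf']; exists f' => //; exact: IHn.
Qed.

Lemma nderiv_cst n (c : R) : nderiv n (fun=> c).
Proof.
elim: n c => [//|n IHn] c; exists (fun=> 0) => [x|]; last exact: IHn.
exact: is_derive_cst.
Qed.

Lemma nderivD n f g : nderiv n f -> nderiv n g -> nderiv n (fun x => f x + g x).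
Proof.
elim: n f g => [//|n IHn] f g [f' df hf'] [g' dg hg'].
by exists (fun x => f' x + g' x) => [x|]; [exact: is_deriveD|exact: IHn].
Qed.

Lemma nderivM n f g : nderiv n f -> nderiv n g -> nderiv n (fun x => f x * g x).
Proof.
elim: n f g => [//|n IHn] f g hf hg.
have hf0 := nderivW hf; have hg0 := nderivW hg.
case: hf hg => [f' df hf'] [g' dg hg'].
exists (fun x => f x * g' x + g x * f' x) => [x|].
  exact: (is_deriveM (df x) (dg x)).
by apply: nderivD; exact: IHn.
Qed.

Lemma nderiv_expR n f : nderiv n f -> nderiv n (fun x => expR (f x)).
Proof.
elim: n f => [//|n IHn] f hf; have hf0 := nderivW hf; case: hf => [f' df hf'].
exists (fun x => expR (f x) * f' x) => [x|].
  exact: (is_derive1_comp (is_derive_expR (f x)) (df x)).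
by apply: nderivM => //; exact: IHn.
Qed.

Local Notation scf := (@smooth_circle_fun R).

Lemma scf_nderiv f : (forall n, nderiv n f) -> (forall x, f (x + 1) = f x) -> scf f.
Proof. by move=> h p; split=> //; apply/nderivP. Qed.

Lemma nderiv_scf f n : scf f -> nderiv n f.
Proof. by case=> h _; exact: ((nderivP f).2 h n). Qed.

Lemma scf_cst c : scf (fun=> c).
Proof. by apply: scf_nderiv => // n; exact: nderiv_cst. Qed.

Lemma scf_lin a b f g : scf f -> scf g -> scf (fun x => a * f x + b * g x).
Proof.
move=> hf hg; apply: scf_nderiv => [n|x]; last by rewrite hf.2 hg.2.
by apply: nderivD; apply: nderivM; try exact: nderiv_cst; exact: nderiv_scf.
Qed.

Lemma scf_expR f : scf f -> scf (fun x => expR (f x)).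
Proof.
move=> hf; apply: scf_nderiv => [n|x]; last by rewrite hf.2.
by apply/nderiv_expR/nderiv_scf.
Qed.

Lemma scf_is_derive f n x : scf f -> is_derive x 1 (derive1n n f) (derive1n n.+1 f x).
Proof. by move=> [h _]; rewrite derive1nS; exact/is_derive_derive1/h. Qed.

Lemma scf_continuous f n : scf f -> continuous (derive1n n f).
Proof. by move=> [h _] x; exact/differentiable_continuous/derivable1_diffP/h. Qed.

Lemma scf_continuous0 f : scf f -> continuous f.
Proof. by move=> hf; have := @scf_continuous f 0 hf; rewrite derive1n0. Qed.

Lemma scf_derive1n f n : scf f -> scf (derive1n n f).
Proof.
move=> hf; split=> [m x|].
  have -> : derive1n m (derive1n n f) = derive1n (n + m) f.
    by elim: m => [|m IHm]; rewrite ?derive1n0 ?addn0 // addnS !derive1nS IHm.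
  exact: hf.1.
elim: n => [|n IHn] x; first by rewrite !derive1n0; exact: hf.2.
have h1 := @scf_is_derive f n (x + 1 * 1) hf.
have := is_derive_shift h1.
rewrite [X in is_derive _ _ X](_ : _ = derive1n n f); last first.
  by apply/funext => y; rewrite mulr1 IHn.
rewrite mulr1 => -[_ <-]; by have [_ <-] := @scf_is_derive f n x hf.
Qed.

Lemma scf_floor f x : scf f -> f x = f (x - (Num.floor x)%:~R).
Proof.
move=> hf; have pn m y : f (y + m%:R) = f y.
  by elim: m => [|m IHm]; rewrite ?addr0 // -natr1 addrA hf.2.
case: (Num.floor x) => m; first by rewrite -(pn m (x - _)) subrK.
by rewrite NegzE rmorphN /= opprK (pn m.+1).
Qed.

Lemma scf_bounded f : scf f -> exists2 M, 0 <= M & bounded_by f M.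
Proof.
move=> hf.
have cf : continuous (fun x => `|f x|).
  by move=> x; apply: (@cvg_norm _ R^o); exact: (scf_continuous0 hf).
have [c _ hc] := EVT_max ler01 (continuous_subspaceT cf).
exists `|f c| => // x; rewrite (scf_floor x hf); apply: hc.
have := floorD1_gt x; rewrite intrD1 => /ltW fx.
by rewrite in_itv /= subr_ge0 floor_le lerBlDl.
Qed.

Lemma scf_gt0_lb f : scf f -> (forall x, 0 < f x) ->
    exists2 c, 0 < c & forall x, c <= f x.
Proof.
move=> hf f0.
have [c _ hc] := EVT_min ler01 (continuous_subspaceT (scf_continuous0 hf)).
exists (f c) => // x; rewrite (scf_floor x hf); apply: hc.
have := floorD1_gt x; rewrite intrD1 => /ltW fx.
by rewrite in_itv /= subr_ge0 floor_le lerBlDl.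
Qed.

End Smooth.

(** * Means and primitives *)

Section Primitive.
Variable R : realType.
Notation mu := (@lebesgue_measure R).
Implicit Types (f g : R -> R) (x s z : R).
Local Notation scf := (@smooth_circle_fun R).

Definition circle_mean f : R := \int[mu]_(s in `[0, 1]) f s.

Lemma unit_integrable f : continuous f -> mu.-integrable `[0, 1] (EFin \o f).
Proof.
move=> cf; apply: continuous_compact_integrable; first exact: segment_compact.
exact: continuous_subspaceT.
Qed.

Lemma unit_measure1 : fine (mu `[(0:R), 1]) = 1.
Proof. by rewrite lebesgue_measure_itv /= lte_fin ltr01 oppr0 adde0. Qed.

Lemma circle_mean_lin a b f g : continuous f -> continuous g ->
  circle_mean (fun x => a * f x + b * g x) = a * circle_mean f + b * circle_mean g.
Proof.
move=> cf cg; rewrite /circle_mean.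
have i1 := unit_integrable cf; have i2 := unit_integrable cg.
rewrite -!RintegralZl // -RintegralD //.
- by apply: unit_integrable => x; apply: cvgM; [exact: cvg_cst|exact: cf].
- by apply: unit_integrable => x; apply: cvgM; [exact: cvg_cst|exact: cg].
Qed.

Lemma circle_mean_cst c : circle_mean (fun=> c) = c.
Proof. by rewrite /circle_mean Rintegral_cst // unit_measure1 mulr1. Qed.

Lemma circle_mean_ge c f : continuous f -> (forall x, c <= f x) -> c <= circle_mean f.
Proof.
move=> cf cf'; rewrite -[leLHS](circle_mean_cst c).
apply: le_Rintegral => //; apply: unit_integrable => //; exact: cst_continuous.
Qed.

Lemma scale_continuous f x : continuous f -> continuous (fun s : R => f (x * s)).
Proof.
by move=> cf; have := @continuous_affine _ f 0 x cf; under eq_fun do rewrite add0r.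
Qed.

(** The primitive is x * \int_0^1 f (x s) ds, which makes sense for x of both
    signs.  Its derivative is the integral over [0, 1] of the derivative of
    s |-> s f (x s). *)
Lemma primitive_exists f : scf f -> exists2 P : R -> R,
  forall x, is_derive x 1 P (f x) & P 1 - P 0 = circle_mean f.
Proof.
move=> hf.
have cf : continuous f := scf_continuous0 hf.
have cf' : continuous (derive1 f).
  by have := @scf_continuous _ f 1 hf; rewrite derive1n1.
have df x : is_derive x 1 f (derive1 f x).
  by have := @scf_is_derive _ f 0 x hf; rewrite derive1n0 derive1n1.
have [M' M'0 f'M] : exists2 M, 0 <= M & bounded_by (derive1 f) M.
  by have := scf_bounded (scf_derive1n 1 hf); rewrite derive1n1.
pose Q x := \int[mu]_(s in `[0, 1]) f (x * s).
exists (fun x => x * Q x); last first.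
  rewrite mul1r mul0r subr0 /Q /circle_mean.
  by apply: eq_Rintegral => s _; rewrite mul1r.
move=> x.
have I0 : `]x - 1, x + 1[%classic x by rewrite /= in_itv /= ltrBlDr ltrDl ltr01.
have ig l : `]x - 1, x + 1[%classic l ->
    mu.-integrable `[0, 1] (EFin \o (fun s => f (l * s))).
  by move=> _; apply: unit_integrable; exact: scale_continuous.
have ds (l s : R) : is_derive l 1 (fun l : R => f (l * s)) (derive1 f (l * s) * s).
  have := @is_derive_scale _ f (derive1 f (l * s)) 0 l s.
  rewrite add0r => /(_ (df _)).
  by rewrite (_ : (fun l0 => f (0 + l0 * s)) = (fun l0 => f (l0 * s))) //;
      apply/funext => ?; rewrite add0r.
have dg' (l s : R) : `]x - 1, x + 1[%classic l -> `[0, 1]%classic s ->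
    derivable ((fun l s : R => f (l * s))^~ s) l 1.
  by move=> _ _; case: (ds l s).
have p1 (l s : R) : partial1of2 (fun l s : R => f (l * s)) l s = derive1 f (l * s) * s.
  by rewrite partial1of2E; case: (ds l s).
pose G (s : R) := M'.
have iG : mu.-integrable `[0, 1] (EFin \o G).
  by apply: unit_integrable; exact: cst_continuous.
have Gub (l s : R) : `]x - 1, x + 1[%classic l -> `[0, 1]%classic s ->
    `|partial1of2 (fun l s : R => f (l * s)) l s| <= G s.
  move=> _; rewrite /= in_itv /= p1 normrM => /andP[s0 s1].
  by rewrite -[leRHS]mulr1 ler_pM // ger0_norm.
have G0 (s : R) : 0 <= G s by [].
have dQ : is_derive x 1 Q (\int[mu]_(s in `[0, 1]) (derive1 f (x * s) * s)).
  apply: DeriveDef.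
    by refine (derivable_under_integral _ I0 ig dg' G0 iG Gub); exact: measurable_itv.
  rewrite -derive1E (differentiation_under_integral _ I0 ig dg' G0 iG Gub) //.
  by apply: eq_Rintegral => z _; rewrite p1.
have dP := is_deriveM (is_derive_id x 1) dQ.
suff -> : f x = x *: (\int[mu]_(s in `[0, 1]) (derive1 f (x * s) * s)) +
    Q x *: 1 by exact: dP.
have ch : continuous (fun s => x * (derive1 f (x * s) * s)).
  move=> s; apply: cvgM; first exact: cvg_cst.
  by apply: cvgM; [exact: scale_continuous|exact: cvg_id].
have cds : continuous (fun s => derive1 f (x * s) * s).
  by move=> s; apply: cvgM; [exact: scale_continuous|exact: cvg_id].
rewrite /GRing.scale /= mulr1 /Q -RintegralZl //; last exact: unit_integrable.
rewrite -RintegralD //; first last.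
- by apply: unit_integrable; exact: scale_continuous.
- exact: unit_integrable.
have dsf (s : R) : is_derive s 1 (fun s : R => s * f (x * s))
    (x * (derive1 f (x * s) * s) + f (x * s)).
  have d1 : is_derive s 1 (fun s : R => f (x * s)) (derive1 f (x * s) * x).
    have -> : (fun s : R => f (x * s)) = (fun s => f (s * x)).
      by apply/funext => u; rewrite mulrC.
    by rewrite (mulrC x s); exact: ds.
  have := is_deriveM (is_derive_id s 1) d1.
  rewrite /GRing.scale /= mulr1 [X in is_derive _ _ _ X](_ : _ =
      x * (derive1 f (x * s) * s) + f (x * s)) //.
  by ring.
rewrite /Rintegral (@continuous_FTC2 _ _ (fun s : R => s * f (x * s))) //.
- by rewrite /= mulr1 mul1r mul0r subr0.
- apply: continuous_subspaceT => s; apply: cvgD; first exact: ch.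
  exact: scale_continuous.
- have cs : continuous (fun s : R => s * f (x * s)).
    by move=> s; apply: cvgM; [exact: cvg_id|exact: scale_continuous].
  split.
  + by move=> s _; case: (dsf s).
  + by apply: cvg_at_right_filter; exact: cs.
  + by apply: cvg_at_left_filter; exact: cs.
- by move=> s _; rewrite derive1E; case: (dsf s).
Qed.

(** Removing the mean is what makes the primitive periodic. *)
Lemma scf_primitive f : scf f -> exists2 F, scf F &
  forall x, is_derive x 1 F (f x - circle_mean f).
Proof.
move=> hf; have [P dP P10] := primitive_exists hf.
set m := circle_mean f in P10 *.
pose F x := P x - m * x.
have dF x : is_derive x 1 F (f x - m).
  have d1 : is_derive x 1 (fun x : R => m * x) m.
    rewrite [X in is_derive _ _ X](_ : _ = m \*: id) //.
    by apply: is_derive_eq; rewrite /GRing.scale /= mulr1.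
  exact: is_deriveB.
exists F => //; apply: scf_nderiv => [n|x].
  case: n => [//|n]; exists (fun x => f x - m) => //.
  have := @nderiv_scf _ _ n (scf_lin 1 (-1) hf (scf_cst m)).
  by under eq_fun do rewrite mul1r mulN1r.
have dd y : is_derive y (1:R) (fun y => F (y + 1) - F y) 0.
  have d1 : is_derive y 1 (fun y => F (y + 1 * 1)) (f (y + 1) - m).
    by apply: is_derive_shift; rewrite mulr1.
  rewrite mulr1 in d1.
  have := is_deriveB d1 (dF y); by rewrite hf.2 subrr.
have := @is_derive_0_is_cst _ _ x 0 dd.
rewrite /F add0r mulr1 mulr0 subr0 => h.
by move/eqP: h; rewrite (addrAC (P 1)) P10 subrr subr_eq0 => /eqP.
Qed.

End Primitive.

(** * The heat equation on the circle *)

Section Heat.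
Variable R : realType.
Notation mu := (@lebesgue_measure R).
Implicit Types (f g : R -> R) (x s z t : R).
Local Notation scf := (@smooth_circle_fun R).

(** Averages over the scale 4 sqrt t solve u_t = 4 u''. *)
Definition heat f t x : R := heat_avg (4 * Num.sqrt t) f x.

Lemma lipschitz_of_derive f f' M : (forall x, is_derive x 1 f (f' x)) ->
  bounded_by f' M -> forall x y, `|f x - f y| <= M * `|x - y|.
Proof.
move=> df f'M x y.
have cf : continuous f.
  by move=> u; apply/differentiable_continuous/derivable1_diffP; case: (df u).
wlog xy : x y / x < y => [h|].
  have [xy|xy|->] := ltgtP x y; first exact: h.
    by rewrite distrC (distrC x); exact: h.
  by rewrite !subrr normr0 mulr0.
have [c _ h] := @MVT _ f f' x y xy (fun u _ => df u) (continuous_subspaceT cf).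
by rewrite distrC h normrM (distrC y) ler_wpM2r.
Qed.

(** The bound on the difference in s uses that |z| is integrable for the
    kernel. *)
Lemma heat_avg_lipschitz f f' Mf M s s' x x' : continuous f -> bounded_by f Mf ->
  (forall x, is_derive x 1 f (f' x)) -> bounded_by f' M -> 0 <= M ->
  `|heat_avg s f x - heat_avg s' f x'| <= M * (`|x - x'| + `|s - s'|) * dom_mass R.
Proof.
move=> cf fM df f'M M0; rewrite /heat_avg.
have i1 := avg_integrable x s cf fM; have i2 := avg_integrable x' s' cf fM.
rewrite -RintegralB //; apply: norm_integral_le_dom.
  by move=> z; apply: cvgB; exact: avg_continuous.
move=> z; rewrite -mulrBl normrM (ger0_norm (gauss_kernel_ge0 z)).
apply: (@le_trans _ _ (M * (`|x - x'| + `|s - s'| * `|z|) * gauss_kernel z)).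
  rewrite ler_wpM2r ?gauss_kernel_ge0 // (le_trans (lipschitz_of_derive df f'M _ _)) //.
  rewrite ler_wpM2l //.
  have -> : x + s * z - (x' + s' * z) = (x - x') + (s - s') * z by ring.
  by rewrite (le_trans (ler_normD _ _)) // normrM.
rewrite -!mulrA ler_wpM2l // !mulrDl lerD //.
  by rewrite ler_wpM2l // gauss_kernel_le.
rewrite -mulrA ler_wpM2l //.
by have := abs_mul_gauss_kernel_le z; rewrite normrM (ger0_norm (gauss_kernel_ge0 z)).
Qed.

Lemma scf_is_derive0 f x : scf f -> is_derive x 1 f (derive1 f x).
Proof.
by move=> hf; have := @scf_is_derive _ f 0 x hf; rewrite derive1n0 derive1n1.
Qed.

Lemma scf_derive1 f : scf f -> scf (derive1 f).
Proof. by move=> hf; have := scf_derive1n 1 hf; rewrite derive1n1. Qed.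

Lemma heat_continuous f : scf f -> continuous (fun p : R * R => heat f p.1 p.2).
Proof.
move=> hf p; have [Mf _ fM] := scf_bounded hf.
have [M M0 f'M] := scf_bounded (scf_derive1 hf).
pose B (q : R * R) : R :=
  M * (`|p.2 - q.2| + `|4 * Num.sqrt p.1 - 4 * Num.sqrt q.1|) * dom_mass R.
have cB : B q @[q --> p] --> (0 : R).
  have -> : (0 : R) = B p by rewrite /B !subrr normr0 addr0 mulr0 mul0r.
  apply: cvgM; last exact: cvg_cst.
  apply: cvgM; first exact: cvg_cst.
  apply: cvgD; apply: (@cvg_norm _ R^o); apply: cvgB; try exact: cvg_cst.
    exact: cvg_snd.
  apply: cvgM; first exact: cvg_cst.
  apply: (@cvg_comp _ _ _ fst Num.sqrt); first exact: cvg_fst.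
  exact: sqrt_continuous.
apply/cvgrPdist_lt => e e0; near=> q.
apply: (@le_lt_trans _ _ (B q)).
  exact: (@heat_avg_lipschitz f (derive1 f) Mf M _ _ _ _ (scf_continuous0 hf)
      fM (fun u => scf_is_derive0 u hf) f'M M0).
by near: q; by apply: (cvgr_lt 0).
Unshelve. all: by end_near. Qed.

Lemma heat_continuous_t f x : scf f -> continuous (heat f ^~ x).
Proof.
move=> hf t.
apply: (@continuous_comp _ _ _ (fun t => (t, x)) (fun p : R * R => heat f p.1 p.2)).
  exact: (cvg_pair (@cvg_id _ _) (cvg_cst _)).
exact: heat_continuous.
Qed.

Lemma heat_dx f t x : scf f -> is_derive x 1 (heat f t) (heat (derive1 f) t x).
Proof.
move=> hf; have [M _ fM] := scf_bounded hf.
have [M' _ f'M] := scf_bounded (scf_derive1 hf).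
exact: (@heat_avg_dx _ f (derive1 f) M M' (scf_continuous0 hf) fM f'M
  (fun u => scf_is_derive0 u hf) (4 * Num.sqrt t) x).
Qed.

(** Differentiating the scale s = 4 sqrt t produces an integral against z times
    the kernel, which [heat_avg_stein] turns into s / 2 times an average of
    f''; and s / 2 * s' = 4. *)
Lemma heat_dt f t x : scf f -> 0 < t ->
  is_derive t 1 (heat f ^~ x) (4 * heat (derive1 (derive1 f)) t x).
Proof.
move=> hf t0; have hf' := scf_derive1 hf; have hf'' := scf_derive1 hf'.
have [M _ fM] := scf_bounded hf; have [M' _ f'M] := scf_bounded hf'.
have [M'' _ f''M] := scf_bounded hf''.
have ds := heat_avg_ds (scf_continuous0 hf) fM f'M
  (fun u => scf_is_derive0 u hf) (4 * Num.sqrt t) x.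
have st := heat_avg_stein (scf_continuous0 hf') f'M (scf_continuous0 hf'') f''M
  (fun u => scf_is_derive0 u hf') (4 * Num.sqrt t) x.
have dsq : is_derive t 1 (fun t => 4 * Num.sqrt t) (4 * (2 * Num.sqrt t)^-1).
  exact: (@is_deriveZ _ _ _ Num.sqrt 4 t 1 _ (is_derive1_sqrt t0)).
have := @is_derive1_comp _ (fun s => heat_avg s f x) (fun t => 4 * Num.sqrt t)
    t _ _ ds dsq.
rewrite /heat; set I := Rintegral _ _ _ in st *.
rewrite [X in is_derive _ _ _ X](_ : _ =
    4 * heat_avg (4 * Num.sqrt t) (derive1 (derive1 f)) x) //.
have s0 : Num.sqrt t != 0 by rewrite gt_eqF // sqrtr_gt0.
apply: (mulfI s0); move: st; set H := heat_avg _ _ _ => st.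
have -> : Num.sqrt t * (4 * H) = 4 * Num.sqrt t * H by ring.
by rewrite -st; field.
Qed.

(** By the mean value theorem a difference quotient of h is a value of k at an
    intermediate time.  This covers t = 0, where the square root has no
    derivative. *)
Lemma difference_quotient_cvg (h k : R -> R) : continuous h -> continuous k ->
  (forall t, 0 < t -> is_derive t 1 h (k t)) -> forall t, 0 <= t ->
  (s - t)^-1 * (h s - h t) @[s --> within [set s | 0 <= s] t^'] --> k t.
Proof.
move=> ch ck dh t t0; apply/cvgrPdist_lt => e e0.
have /cvgrPdist_lt /(_ e e0) [d /= d0 hd] := ck t.
rewrite !near_withinE; exists d => //= s /= sd st s0.
have mvt a b : a < b -> 0 <= a ->
    exists2 c, a < c < b & h b - h a = k c * (b - a).
  move=> ab a0.
  have dh' u : u \in `]a, b[ -> is_derive u 1 h (k u).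
    by rewrite in_itv /= => /andP[au _]; exact/dh/(le_lt_trans a0 au).
  have [u uab ->] := MVT ab dh' (continuous_subspaceT ch).
  by exists u => //; move: uab; rewrite in_itv.
have [c ct hc] : exists2 c, `|t - c| < d & h s - h t = k c * (s - t).
  have [lt_st|lt_ts|eq_st] := ltgtP s t; last by rewrite eq_st eqxx in st.
    have [c /andP[c1 c2] hc] := mvt s t lt_st s0.
    exists c; last by rewrite -opprB hc -mulrN opprB.
    apply: lt_trans sd; rewrite !ger0_norm ?subr_ge0 ?(ltW c2) ?(ltW lt_st) //.
    by rewrite ltrD2l ltrN2.
  have [c /andP[c1 c2] hc] := mvt t s lt_ts t0.
  exists c => //.
  apply: lt_trans sd; rewrite !ler0_norm ?subr_le0 ?(ltW c1) ?(ltW lt_ts) //.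
  by rewrite !opprB ltrD2r.
rewrite hc mulrC mulfK ?subr_eq0 //; exact: hd.
Qed.

End Heat.

(** * Long time behaviour of the heat equation *)

Section HeatLimit.
Variable R : realType.
Implicit Types (f g : R -> R) (x s z t : R).
Local Notation scf := (@smooth_circle_fun R).

Lemma heat_derive1n f t k : scf f -> derive1n k (heat f t) = heat (derive1n k f) t.
Proof.
move=> hf; elim: k => [|k IHk]; first by rewrite !derive1n0.
rewrite !derive1nS IHk; apply: is_derive_eq_derive1 => x.
by apply: heat_dx; exact: scf_derive1n.
Qed.

Lemma heat_scf f t : scf f -> scf (heat f t).
Proof.
move=> hf; split=> [n x|x]; last exact/heat_avg_period/hf.2.
by rewrite heat_derive1n //; case: (heat_dx t x (scf_derive1n n hf)).
Qed.

Lemma heat_lin a b f g t x : scf f -> scf g ->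
  heat (fun y => a * f y + b * g y) t x = a * heat f t x + b * heat g t x.
Proof.
move=> hf hg; have [Mf _ fM] := scf_bounded hf; have [Mg _ gM] := scf_bounded hg.
exact: heat_avg_lin (scf_continuous0 hf) fM (scf_continuous0 hg) gM.
Qed.

Lemma heat_cst c t x : heat (fun=> c) t x = c.
Proof. exact: heat_avg_cst. Qed.

Lemma heat_ge c f t x : scf f -> (forall y, c <= f y) -> c <= heat f t x.
Proof.
move=> hf; have [M _ fM] := scf_bounded hf.
exact: heat_avg_ge (scf_continuous0 hf) fM.
Qed.

Lemma heat0 f : heat f 0 = f.
Proof. by apply/funext => x; rewrite /heat sqrtr0 mulr0 heat_avg0. Qed.

Lemma heat_decay f : scf f ->
  exists2 C, 0 <= C & forall t x, 0 < t -> `|heat (derive1 f) t x| <= C / Num.sqrt t.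
Proof.
move=> hf; have hf' := scf_derive1 hf.
have [M M0 fM] := scf_bounded hf; have [M' _ f'M] := scf_bounded hf'.
exists (2 * M * dom_mass R / 4) => [|t x t0].
  by rewrite !mulr_ge0 ?dom_mass_ge0.
rewrite -[leRHS]mulrA -invfM.
apply: (heat_avg_decay (scf_continuous0 hf) fM (scf_continuous0 hf') f'M
  (fun u => scf_is_derive0 u hf)).
by rewrite mulr_gt0 ?sqrtr_gt0.
Qed.

(** f minus its mean is the derivative of a periodic function, so its evolution
    decays. *)
Lemma heat_to_mean f : scf f ->
  exists2 C, 0 <= C &
    forall t x, 0 < t -> `|heat f t x - circle_mean f| <= C / Num.sqrt t.
Proof.
move=> hf; have [F hF dF] := scf_primitive hf.
have [C C0 hC] := heat_decay hF; exists C => // t x t0.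
have -> : heat f t x - circle_mean f = heat (derive1 F) t x; last exact: hC.
rewrite (is_derive_eq_derive1 dF).
have -> : (fun x => f x - circle_mean f) =
    (fun x => 1 * f x + (-1) * (fun=> circle_mean f) x).
  by apply/funext => y; rewrite mul1r mulN1r.
by rewrite heat_lin ?heat_cst ?mul1r ?mulN1r //; exact: scf_cst.
Qed.

Lemma sqrt_decay (C e : R) : 0 <= C -> 0 < e ->
    \forall t \near +oo, 0 < t /\ C / Num.sqrt t < e.
Proof.
move=> C0 e0; near=> t.
have t0 : 0 < t by near: t; exact: nbhs_pinfty_gt.
split=> //; rewrite ltr_pdivrMr ?sqrtr_gt0 // -ltr_pdivrMl //.
rewrite -[ltLHS]ger0_norm ?mulr_ge0 ?invr_ge0 ?(ltW e0) // -sqrtr_sqr ltr_sqrt //.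
by near: t; apply: nbhs_pinfty_gt; rewrite num_real.
Unshelve. all: by end_near. Qed.

Lemma heat_cvg_mean f (e : R) : scf f -> 0 < e ->
  \forall t \near +oo, forall x, `|heat f t x - circle_mean f| < e.
Proof.
move=> hf e0; have [C C0 hC] := heat_to_mean hf.
near=> t => x.
have [t0 te] : 0 < t /\ C / Num.sqrt t < e by near: t; exact: sqrt_decay.
by rewrite (le_lt_trans (hC t x t0)).
Unshelve. all: by end_near. Qed.

Lemma heat_derive_cvg0 f k (e : R) : scf f -> 0 < e ->
  \forall t \near +oo, forall x, `|heat (derive1n k.+1 f) t x| < e.
Proof.
move=> hf e0; have [C C0 hC] := heat_decay (scf_derive1n k hf).
near=> t => x.
have [t0 te] : 0 < t /\ C / Num.sqrt t < e by near: t; exact: sqrt_decay.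
by rewrite derive1nS (le_lt_trans (hC t x t0)).
Unshelve. all: by end_near. Qed.

End HeatLimit.

(** * Forms depending on the first coordinate only *)

Section Fields.
Variable R : realType.
Implicit Types (f g h : R -> R) (x : R6 R).
Local Notation scf := (@smooth_circle_fun R).
Local Notation x1 x := (x 0 (ix 1)).

Lemma scf_mul f g : scf f -> scf g -> scf (fun y => f y * g y).
Proof.
move=> hf hg; apply: scf_nderiv => [n|y]; last by rewrite hf.2 hg.2.
by apply: nderivM; exact: nderiv_scf.
Qed.

Lemma scf_scale (c : R) f : scf f -> scf (fun y => f y * c).
Proof. by move=> hf; apply: scf_mul => //; exact: scf_cst. Qed.

Lemma scf_add f g : scf f -> scf g -> scf (fun y => f y + g y).
Proof.
move=> hf hg; have := scf_lin 1 1 hf hg.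
by under eq_fun do rewrite !mul1r.
Qed.

Lemma scf_sum (E : Type) (r : seq E) (F : E -> R -> R) :
  (forall e, scf (F e)) -> scf (fun y => \sum_(e <- r) F e y).
Proof.
move=> hF; elim: r => [|e r IHr].
  by under eq_fun do rewrite big_nil; exact: scf_cst.
by under eq_fun do rewrite big_cons; exact: scf_add.
Qed.

Lemma derive1n_lin a b f g k : scf f -> scf g ->
  derive1n k (fun y => a * f y + b * g y) =
  (fun y => a * derive1n k f y + b * derive1n k g y).
Proof.
move=> hf hg; elim: k => [|k IHk]; first by rewrite !derive1n0.
rewrite !derive1nS IHk -!derive1nS; apply: is_derive_eq_derive1 => y.
apply: is_deriveD; apply: (@is_deriveZ _ _ _ _ _ y 1); exact: scf_is_derive.
Qed.

Lemma derive1_sum (E : Type) (r : seq E) (F : E -> R -> R) (c : E -> R) :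
  (forall e, scf (F e)) ->
  derive1 (fun y => \sum_(e <- r) F e y * c e) =
  (fun y => \sum_(e <- r) derive1 (F e) y * c e).
Proof.
move=> hF; apply: is_derive_eq_derive1 => y; elim: r => [|e r IHr].
  by under eq_fun do rewrite big_nil; rewrite big_nil; exact: is_derive_cst.
under eq_fun do rewrite big_cons; rewrite big_cons.
by apply: is_deriveD => //; apply/is_derive_mulr/scf_is_derive0.
Qed.

Lemma ix1E : nat_of_ord (ix 1) = 0%N.
Proof. by rewrite ixE. Qed.

Lemma coord_is_derive h (dh : R) i x : is_derive (x1 x) 1 h dh ->
  is_derive x (basis_vec R i) (fun y : R6 R => h (x1 y)) (kron R 0 i * dh).
Proof.
move=> dhx.
have E : (fun t : R => t^-1 *:
    (((fun y : R6 R => h (x1 y)) \o shift x) (t *: basis_vec R i) - h (x1 x))) =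
  (if i == ix 1 then (fun t : R => t^-1 *: ((h \o shift (x1 x)) (t *: 1) - h (x1 x)))
   else fun=> 0).
  apply/funext => t /=; rewrite !mxE /=.
  have [_|_] := eqVneq i (ix 1); first by [].
  by rewrite mulr0 add0r subrr scaler0.
have di : kron R 0 i = (i == ix 1)%:R.
  by rewrite /kron -val_eqE /= ix1E eq_sym; case: eqP.
have [dd <-] := dhx.
apply: DeriveDef; rewrite /derivable /derive E ?di; case: ifP => _ //.
- exact: is_cvg_cst.
- by rewrite mul1r.
- by rewrite mul0r lim_cst.
Qed.

Lemma pderiv_coord h i : scf h ->
  pderiv i (fun y : R6 R => h (x1 y)) = fun y => kron R 0 i * derive1 h (x1 y).
Proof.
move=> hh; apply/funext => y; rewrite /pderiv.
by have [_ ->] := coord_is_derive i (scf_is_derive0 (x1 y) hh).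
Qed.

Lemma pderivs_coord h s : scf h ->
  pderivs s (fun y : R6 R => h (x1 y)) =
  fun y => (all (pred1 (ix 1)) s)%:R * derive1n (size s) h (x1 y).
Proof.
move=> hh; elim: s => [|i s IHs]; first by apply/funext => y /=; rewrite mul1r.
rewrite [LHS]/= -/(pderivs s _) IHs.
have hk : scf (fun y => (all (pred1 (ix 1)) s)%:R * derive1n (size s) h y).
  by under eq_fun do rewrite mulrC; apply/scf_scale/scf_derive1n.
rewrite (pderiv_coord i hk); apply/funext => y /=.
have -> : derive1 (fun y => (all (pred1 (ix 1)) s)%:R * derive1n (size s) h y) =
   fun y => (all (pred1 (ix 1)) s)%:R * derive1n (size s).+1 h y.
  apply: is_derive_eq_derive1 => z.
  by apply: (@is_deriveZ _ _ _ (derive1n (size s) h)); exact: scf_is_derive.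
rewrite mulrA; congr (_ * _); rewrite /kron -val_eqE /= ix1E eq_sym.
by case: eqP => _; rewrite ?mul1r ?mul0r.
Qed.

Lemma continuous_of_x1 (h : R -> R) : continuous h ->
    continuous (fun y : R6 R => h (x1 y)).
Proof.
move=> ch y; apply: (@continuous_comp _ _ _ (fun y : R6 R => x1 y) h); last exact: ch.
exact: coord_continuous.
Qed.

Lemma smooth_coord h : scf h -> smooth_fun (fun y : R6 R => h (x1 y)).
Proof.
move=> hh s; rewrite pderivs_coord //.
have hk : scf (fun y => (all (pred1 (ix 1)) s)%:R * derive1n (size s) h y).
  by under eq_fun do rewrite mulrC; apply/scf_scale/scf_derive1n.
split; first exact: (continuous_of_x1 (scf_continuous0 hk)).
by move=> i x; have [dd _] := coord_is_derive i (scf_is_derive0 (x1 x) hk).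
Qed.

Lemma periodic_coord h : scf h -> periodic_fun (fun y : R6 R => h (x1 y)).
Proof.
move=> hh i x; rewrite !mxE eqxx /=; case: eqP => _; last by rewrite addr0.
by rewrite hh.2.
Qed.

(** Forms whose coefficients depend on x^1 only; d differentiates the
    coefficients and prepends dx^1, as [ext_d_x1_form] shows. *)
Definition x1_form k (E : Type) (r : seq E) (f : E -> R -> R) (A : E -> seq nat)
    : tensor_field R k :=
  fun x I => \sum_(e <- r) f e (x1 x) * list_det R (A e) (nat_indices I).

Lemma ext_d_x1_form (k : nat) (E : Type) (r : seq E) (f : E -> R -> R)
    (A : E -> seq nat) : (forall e, scf (f e)) ->
  ext_d (@x1_form k E r f A) =
  @x1_form k.+1 E r (fun e => derive1 (f e)) (fun e => 0%N :: A e).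
Proof.
move=> hf; apply/funext => x; apply/funext => I; rewrite /ext_d /x1_form.
under [RHS]eq_bigr do rewrite list_det_cons size_map size_tuple big_distrr /=.
rewrite exchange_big /=; apply: eq_bigr => j _.
pose c e := list_det R (A e) (nat_indices [tuple tnth I (lift j l) | l < k]).
have hF : scf (fun y => \sum_(e <- r) f e y * c e).
  by apply: scf_sum => e; exact: scf_scale.
rewrite (pderiv_coord _ hF) derive1_sum // !big_distrr /=; apply: eq_bigr => e _.
rewrite /c map_ord_rem /kron (nth_map ord0) ?size_tuple // -tnth_nth.
by case: eqP => _; rewrite ?mul1r ?mulr1 ?mul0r ?mulr0 ?mul0r ?mulr0 // mulrCA.
Qed.

End Fields.

Section Contraction.
Variable R : realType.
Implicit Types (f g h : R -> R) (x : R6 R).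
Local Notation scf := (@smooth_circle_fun R).
Local Notation x1 x := (x 0 (ix 1)).

Lemma tuple1_eta (I : 1.-tuple 'I_6) : exists u, I = [tuple u].
Proof. case: I => -[|x [|//]] // hI; by exists x; apply: val_inj. Qed.

Lemma tuple4_eta (I : 4.-tuple 'I_6) : exists w u y z, I = [tuple w; u; y; z].
Proof.
case: I => -[|w [|x [|y [|z [|//]]]]] // hI.
by exists w, x, y, z; apply: val_inj.
Qed.

(** The inverse of omega is - omega, which pairs the indices 2 k and
    2 k + 1. *)
Lemma Lam_pairs k (a : tensor R k.+2) I :
  Lam a I = 2^-1 * (
      (a [tuple of inord 0 :: inord 1 :: I] - a [tuple of inord 1 :: inord 0 :: I])
    + (a [tuple of inord 2 :: inord 3 :: I] - a [tuple of inord 3 :: inord 2 :: I])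
    + (a [tuple of inord 4 :: inord 5 :: I] - a [tuple of inord 5 :: inord 4 :: I])).
Proof.
rewrite /Lam omega_mx_inv; congr (_ * _).
pose F (i j : nat) := a [tuple of inord i :: inord j :: I].
have E (i j : 'I_6) : (- omega_mx R) j i * a [tuple of i :: j :: I] =
    - omega_entry R j i * F i j.
  by rewrite mxE omega_mxE /F !inord_val.
under eq_bigr do under eq_bigr do rewrite E.
rewrite !big_ord_recl !big_ord0 /= /bump /= -/(F 0 1)%N -/(F 1 0)%N
  -/(F 2 3)%N -/(F 3 2)%N -/(F 4 5)%N -/(F 5 4)%N.
by ring.
Qed.

Lemma split_form_primitive (T : bool * bool * bool -> R) I : Lam (split_form T) I = 0.
Proof.
have [z ->] := tuple1_eta I; rewrite Lam_pairs /split_form.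
have N (u v : 'I_6) : nat_indices [tuple of u :: v :: [tuple z]] =
  [:: nat_of_ord u; nat_of_ord v; nat_of_ord z] by [].
rewrite !N !inordK // !slots_sum /slot /= !if_kron /=; ring.
Qed.

Lemma list_det4_dup p q r w u y z : list_det R [:: p; p; q; r] [:: w; u; y; z] = 0.
Proof. by rewrite /= !if_kron; ring. Qed.

(** Contraction with omega removes dx^12 when dx^e contains dx^2; otherwise
    dx^1 occurs twice. *)
Lemma Lam_dx1_slot e (I : 2.-tuple 'I_6) :
  Lam (fun J : 4.-tuple 'I_6 => list_det R (0%N :: slot e) (nat_indices J)) I =
  if e.1.1 then list_det R (behead (slot e)) (nat_indices I) else 0.
Proof.
have [u [v ->]] := tuple2_eta I; rewrite Lam_pairs.
have N (i j : 'I_6) : nat_indices [tuple of i :: j :: [tuple u; v]] =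
  [:: nat_of_ord i; nat_of_ord j; nat_of_ord u; nat_of_ord v] by [].
rewrite !N !inordK //.
by case: e => -[x y] z; case: x; case: y; case: z; rewrite /slot /= ?if_kron; field.
Qed.

Lemma Lam_sum k (E : Type) (r : seq E) (c : E -> R) (a : E -> tensor R k.+2) I :
  Lam (fun J => \sum_(e <- r) c e * a e J) I = \sum_(e <- r) c e * Lam (a e) I.
Proof.
elim: r => [|e r IHr].
  rewrite big_nil /Lam big1 ?mulr0 // => i _; rewrite big1 // => j _.
  by rewrite big_nil mulr0.
rewrite big_cons -IHr /Lam mulrCA -mulrDr; congr (_ * _).
rewrite big_distrr -big_split; apply: eq_bigr => i _ /=.
rewrite big_distrr -big_split; apply: eq_bigr => j _ /=.
by rewrite big_cons mulrDr mulrCA.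
Qed.

End Contraction.

(** * The flow equation within the ansatz *)

Section FlowEquation.
Variable R : realType.
Implicit Types (f g h : R -> R) (x : R6 R).
Local Notation scf := (@smooth_circle_fun R).
Local Notation x1 x := (x 0 (ix 1)).

Definition IIA_form (a b c d : R -> R) : tensor_field R 3 :=
  fun x => split_form (phi_slots (a (x1 x)) (b (x1 x)) (c (x1 x)) (d (x1 x))).

Lemma phi_initE (alpha beta gamma delta : R -> R) :
  phi_init alpha beta gamma delta =
  IIA_form (fun y => expR (alpha y)) (fun y => expR (beta y)) gamma delta.
Proof.
apply/funext => x; apply/funext => I; rewrite /phi_init /IIA_form /split_form.
by rewrite !dx3E // slots_sum /slot /=; ring.
Qed.

Lemma IIA_form_positive a b c d :
  (forall y, [/\ 0 < a y, 0 < b y & 0 < disc (a y) (b y) (c y) (d y)]) ->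
  positive_form (IIA_form a b c d).
Proof.
move=> h x; have [a0 b0 D0] := h (x1 x); split.
  by rewrite /IIA_form hitchin_lambda_phi oppr_lt0.
by move=> v v0; exact: g_mx_pos.
Qed.

Lemma positive_disc a b c d : positive_form (IIA_form a b c d) ->
  forall y, 0 < disc (a y) (b y) (c y) (d y).
Proof.
move=> h y; have [] := h (const_mx y).
by rewrite /IIA_form hitchin_lambda_phi mxE oppr_lt0.
Qed.

Lemma IIA_form_primitive a b c d : primitive_form (IIA_form a b c d).
Proof. by move=> x I; exact: split_form_primitive. Qed.

Lemma split_form_alternating (T : bool * bool * bool -> R) :
  alternating_tensor (split_form T).
Proof.
have h (a0 a1 a2 : nat) : alternating_tensor (wedge_prod (covec R (inord a0))
    (wedge_of R a1 a2) : tensor R 3).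
  exact: (@wedge_alternating R 1 2).
move=> s I; rewrite split_formE big_distrr /=; apply: eq_bigr => e _.
rewrite [RHS]mulrCA; congr (_ * _).
exact: h.
Qed.

Lemma scf_opp f : scf f -> scf (fun y => - f y).
Proof.
by move=> hf; have := scf_lin (-1) 0 hf hf; under eq_fun do rewrite mul0r addr0 mulN1r.
Qed.

Lemma scf_mull k f : scf f -> scf (fun y => k * f y).
Proof.
by move=> hf; have := scf_lin k 0 hf hf; under eq_fun do rewrite mul0r addr0.
Qed.

Section Smooth.
Variables a b c d : R -> R.
Hypotheses (ha : scf a) (hb : scf b) (hc : scf c) (hd : scf d).

Lemma scf_phi_slots e : scf (fun y => phi_slots (a y) (b y) (c y) (d y) e).
Proof.
case: e => -[[] []] [].
- exact: (scf_cst 0).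
- exact: (scf_cst (-1)).
- exact: (scf_cst (-1)).
- exact: (scf_cst 0).
- exact: scf_opp.
- exact: hd.
- exact: hc.
- exact: ha.
Qed.

Lemma IIA_formE : IIA_form a b c d =
  x1_form slots (fun e y => phi_slots (a y) (b y) (c y) (d y) e) slot.
Proof. by []. Qed.

Lemma IIA_form_torus : torus_form (IIA_form a b c d).
Proof.
split=> [x|]; first exact: split_form_alternating.
suff h (I : 3.-tuple 'I_6) : exists2 k : R -> R, scf k &
    (fun x => IIA_form a b c d x I) = (fun x : R6 R => k (x1 x)).
  split=> I; have [k hk ->] := h I; first exact: smooth_coord.
  exact: periodic_coord.
exists (fun y => \sum_(e <- slots) phi_slots (a y) (b y) (c y) (d y) e *
                  list_det R (slot e) (nat_indices I)) => //.
by apply: scf_sum => e; apply: scf_scale; exact: scf_phi_slots.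
Qed.

Lemma IIA_form_closed : closed_form (IIA_form a b c d).
Proof.
move=> x I; rewrite IIA_formE ext_d_x1_form; last exact: scf_phi_slots.
rewrite /x1_form big1_seq // => e _; have [w [u [y [z ->]]]] := tuple4_eta I.
case: e => -[[] y'] z'; last by rewrite [list_det _ _ _](list_det4_dup _ 0%N) mulr0.
suff -> : derive1 (fun y => phi_slots (a y) (b y) (c y) (d y) (true, y', z')) = fun=> 0.
  by rewrite mul0r.
by apply: is_derive_eq_derive1 => t; case: y'; case: z'; exact: is_derive_cst.
Qed.

Lemma scf_star_slots e : scf (fun y => star_slots (a y) (b y) (c y) (d y) e).
Proof.
case: e => -[[] []] [].
- exact: (scf_mull _ hb).
- exact: (scf_add hd (scf_opp hc)).
- exact: (scf_add hc (scf_opp hd)).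
- exact: (scf_mull _ ha).
- exact: (scf_mul hb (scf_add hc hd)).
- exact: (scf_add (scf_add (scf_mul (scf_mull 2 ha) hb) (scf_mul hc hd))
    (scf_opp (scf_mul hd hd))).
- exact: (scf_add (scf_add (scf_mul (scf_mull 2 ha) hb) (scf_mul hc hd))
    (scf_opp (scf_mul hc hc))).
- exact: (scf_mul (scf_opp ha) (scf_add hc hd)).
Qed.

Hypothesis disc_gt0 : forall y, 0 < disc (a y) (b y) (c y) (d y).

(** The factor 2 s of |phi|^2 cancels the s^-1 of star phi, so the fields that
    get differentiated are polynomial in a, b, c, d; of these only the
    coefficients of star phi along dx^2 survive, and they are linear. *)
Lemma typeIIA_rhs_IIA x I :
  typeIIA_rhs (IIA_form a b c d) x I =
  split_form (fun e => if e.1.1 then 0 else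
    2 * derive1 (derive1 (fun y =>
      star_slots (a y) (b y) (c y) (d y) (true, e.1.2, e.2))) (x1 x)) I.
Proof.
rewrite /typeIIA_rhs.
pose F e y := 2 * star_slots (a y) (b y) (c y) (d y) e.
have hF e : scf (F e).
  have := scf_lin 2 0 (scf_star_slots e) (scf_cst 0).
  by under eq_fun do rewrite mul0r addr0.
rewrite [X in ext_d (fun x => Lam (ext_d X x))](_ : _ = x1_form slots F slot);
    last first.
  apply/funext => y; apply/funext => J.
  rewrite /hodge_field /metric_of /IIA_form (hodge_phi (disc_gt0 _))
      (norm_sq_phi (disc_gt0 _)).
  rewrite mulrA mulfK; last by rewrite gt_eqF // sqrtr_gt0.
  rewrite /x1_form /split_form big_distrr /=; apply: eq_bigr => e _.
  by rewrite /F mulrA.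
rewrite (@ext_d_x1_form _ 3) //.
rewrite [X in ext_d X](_ : _ = x1_form [seq e <- slots | e.1.1]
   (fun e => derive1 (F e)) (fun e => behead (slot e))); last first.
  apply/funext => y; apply/funext => J.
  rewrite /x1_form Lam_sum big_filter [RHS]big_mkcond /=.
  by apply: eq_bigr => e _; rewrite Lam_dx1_slot; case: ifP => //; rewrite mulr0.
rewrite (@ext_d_x1_form _ 2); last by move=> e; exact: scf_derive1.
pose X e := derive1 (derive1 (fun y => star_slots (a y) (b y) (c y) (d y) e)) (x1 x).
have D2 e : derive1 (derive1 (F e)) (x1 x) = 2 * X e.
  have D1 (f : R -> R) : scf f -> derive1 (fun y => 2 * f y) =
      (fun y => 2 * derive1 f y).
    move=> hf; apply: is_derive_eq_derive1 => u.
    by apply: (@is_deriveZ _ _ _ f); exact: scf_is_derive0.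
  by rewrite /F (D1 _ (scf_star_slots e)) (D1 _ (scf_derive1 (scf_star_slots e))).
rewrite -[RHS]/(split_form (fun e => if e.1.1 then 0 else 2 * X (true, e.1.2, e.2)) I).
rewrite /x1_form; under eq_bigr do rewrite D2.
clearbody X; rewrite /split_form slots_sum !big_cons big_nil /slot.
cbn [fst snd behead].
ring.
Qed.

End Smooth.

End FlowEquation.

(** * Harmonic forms *)

Section Harmonic.
Variable R : realType.
Implicit Types (f g h : R -> R) (x : R6 R).
Local Notation scf := (@smooth_circle_fun R).
Local Notation x1 x := (x 0 (ix 1)).

Lemma hodge0 (g : 'M[R]_6) k (a : tensor R k) : (forall I, a I = 0) ->
  forall J, hodge g a J = 0.
Proof.
move=> a0 J; rewrite /hodge big1 ?mulr0 // => I _.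
by rewrite /raise_indices big1 ?mul0r // => L _; rewrite a0 mulr0.
Qed.

Lemma ext_d0 k (a : tensor_field R k) : (forall x I, a x I = 0) ->
  forall x I, ext_d a x I = 0.
Proof.
move=> a0 x I; rewrite /ext_d big1 // => j _.
rewrite (_ : (fun y => _) = fun=> 0); last by apply/funext => y; exact: a0.
by rewrite /pderiv derive_cst mulr0.
Qed.

Lemma codiff0 (g : R6 R -> 'M[R]_6) k (a : tensor_field R k) :
    (forall x I, a x I = 0) ->
  forall x I, codiff g a x I = 0.
Proof.
move=> a0 x I; rewrite /codiff /hodge_field hodge0 ?oppr0 // => J.
by apply: ext_d0 => y L; exact: hodge0.
Qed.

(** The norm and the coefficients of star phi along dx^2 are constant, and the
    other terms of star phi contain dx^1; hence star phi is closed. *)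
Lemma IIA_form_harmonic (a b m : R) c d : scf c -> scf d ->
  (forall y, c y - d y = m) -> 0 < 4 * a * b - m ^+ 2 ->
  harmonic_form (IIA_form (fun=> a) (fun=> b) c d).
Proof.
move=> hc hd cd D0.
have ha := scf_cst a; have hb := scf_cst b.
have discE y : disc a b (c y) (d y) = 4 * a * b - m ^+ 2 by rewrite /disc cd.
set psi := IIA_form _ _ _ _; set g := metric_of psi.
have closed_star x I : ext_d (hodge_field g psi : tensor_field R 3) x I = 0.
  pose F e y := (Num.sqrt (4 * a * b - m ^+ 2))^-1 * star_slots a b (c y) (d y) e.
  have hF e : scf (F e).
    exact: (scf_mull _ (@scf_star_slots R (fun=> a) (fun=> b) c d ha hb hc hd e)).
  rewrite (_ : hodge_field g psi = x1_form slots F slot); last first.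
    apply/funext => y; apply/funext => J.
    rewrite /hodge_field /g /metric_of /psi /IIA_form hodge_phi ?discE //.
    rewrite /x1_form /split_form big_distrr /=; apply: eq_bigr => e _.
    by rewrite /F mulrA.
  rewrite (@ext_d_x1_form _ 3) // /x1_form big1_seq // => e _.
  have [w [u [y [z ->]]]] := tuple4_eta I.
  case: e => -[[] y'] z'; last by rewrite [list_det _ _ _](list_det4_dup _ 0%N) mulr0.
  suff -> : derive1 (F (true, y', z')) = fun=> 0 by rewrite mul0r.
  have cst k : F (true, y', z') = (fun=> k) -> derive1 (F (true, y', z')) = fun=> 0.
    by move=> ->; apply: is_derive_eq_derive1 => t; exact: is_derive_cst.
  apply: (cst (F (true, y', z') 0)); apply/funext => t; rewrite /F; congr (_ * _).
  have dc s : d s - c s = - m by rewrite -opprB cd.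
  clear cst; by case: y'; case: z'; rewrite /star_slots ?cd ?dc.
move=> x I; rewrite /hodge_laplacian3.
have c0 := @codiff0 g 4 (ext_d psi) (fun y J => IIA_form_closed ha hb hc hd y J).
rewrite [X in _ + X]c0 addr0.
apply: (@ext_d0 2) => y J; rewrite /codiff /hodge_field hodge0 ?oppr0 //.
Qed.

End Harmonic.

(** * Smoothness in space and time *)

Section Spacetime.
Variable R : realType.
Implicit Types (f g h : R -> R) (x : R6 R) (t : R).
Local Notation scf := (@smooth_circle_fun R).
Local Notation x1 x := (x 0 (ix 1)).

Lemma time_derivative_lin a b (u v du dv : R -> R6 R -> R) :
  time_derivative u du -> time_derivative v dv ->
  time_derivative (fun t x => a * u t x + b * v t x)
      (fun t x => a * du t x + b * dv t x).
Proof.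
move=> hu hv t x t0.
rewrite (_ : (fun s => _) = (fun s => a * ((s - t)^-1 * (u s x - u t x))
                                   + b * ((s - t)^-1 * (v s x - v t x)))); last first.
  by apply/funext => s; ring.
by apply: cvgD; apply: cvgMr; [exact: hu|exact: hv].
Qed.

Lemma time_derivative_scale a (u du : R -> R6 R -> R) : time_derivative u du ->
  time_derivative (fun t x => a * u t x) (fun t x => a * du t x).
Proof.
move=> hu t x t0.
rewrite (_ : (fun s => _) = (fun s => a * ((s - t)^-1 * (u s x - u t x)))); last first.
  by apply/funext => s; ring.
by apply: cvgMr; exact: hu.
Qed.

Lemma time_derivative_static (v : R6 R -> R) :
  time_derivative (fun _ x => v x) (fun _ _ => 0).
Proof.
move=> t x t0; rewrite (_ : (fun s => _) = fun=> 0); first exact: cvg_cst.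
by apply/funext => s; rewrite subrr mulr0.
Qed.

Lemma time_derivative_heat f : scf f ->
  time_derivative (fun t x => heat f t (x1 x))
                  (fun t x => 4 * heat (derive1 (derive1 f)) t (x1 x)).
Proof.
move=> hf t x t0; have hf'' := scf_derive1 (scf_derive1 hf).
apply: (@difference_quotient_cvg _ (heat f ^~ (x1 x))
    (fun t => 4 * heat (derive1 (derive1 f)) t (x1 x))) => //.
- exact: heat_continuous_t.
- by move=> s; apply: cvgMr; exact: heat_continuous_t.
- by move=> s s0; exact: heat_dt.
Qed.

Lemma spacetime_smooth_lin a b (u v : R -> R6 R -> R) :
  spacetime_smooth u -> spacetime_smooth v ->
  spacetime_smooth (fun t x => a * u t x + b * v t x).
Proof.
move=> [D [D0 Dc Dt Dx]] [E [E0 Ec Et Ex]].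
exists (fun n s t x => a * D n s t x + b * E n s t x); split.
- by move=> t x t0; rewrite D0 // E0.
- by move=> n s p; apply: cvgD; apply: cvgMr; [exact: Dc|exact: Ec].
- by move=> n s; exact: time_derivative_lin.
- move=> n s i t x t0.
  by apply: is_deriveD; apply: (@is_deriveZ _ _ _ _ _ x); [exact: Dx|exact: Ex].
Qed.

Definition x1_only (s : seq 'I_6) : R := (all (pred1 (ix 1)) s)%:R.

Lemma x1_only_cons i s : x1_only (i :: s) = kron R 0 i * x1_only s.
Proof.
rewrite /x1_only /= /kron -val_eqE /= ix1E eq_sym.
by case: eqP => _; rewrite ?mul1r ?mul0r.
Qed.

(** Two space derivatives trade for one time derivative up to the factor 4. *)
Lemma spacetime_smooth_heat f : scf f -> spacetime_smooth (fun t x => heat f t (x1 x)).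
Proof.
move=> hf.
pose g n (s : seq 'I_6) := derive1n (n.*2 + size s) f.
have hg n s : scf (g n s) by exact: scf_derive1n.
have gt n s : derive1 (derive1 (g n s)) = g n.+1 s.
  by rewrite /g -!derive1nS doubleS !addSn.
have gx n i s : derive1 (g n s) = g n (i :: s) by rewrite /g -derive1nS addnS.
exists (fun n s t x => (x1_only s * 4 ^+ n) * heat (g n s) t (x1 x)); split.
- by move=> t x _; rewrite /x1_only /= expr0 !mul1r /g derive1n0.
- move=> n s; apply: continuous_subspaceT => p; apply: cvgMr.
  apply: (@continuous_comp _ _ _ (fun p : R * R6 R => (p.1, x1 p.2))
           (fun q : R * R => heat (g n s) q.1 q.2)); last exact: heat_continuous.
  have c2 : (fun q : R * R6 R => x1 q.2) @ p --> x1 p.2.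
    apply: (@continuous_comp _ _ _ snd (fun y : R6 R => x1 y)); first exact: cvg_snd.
    exact: coord_continuous.
  exact: (cvg_pair (@cvg_fst _ _ _ _ _) c2).
- move=> n s t x t0; have := @time_derivative_scale (x1_only s * 4 ^+ n)
    _ _ (time_derivative_heat (hg n s)) t x t0.
  by rewrite gt exprSr !mulrA.
- move=> n s i t x t0; rewrite x1_only_cons -(gx n i s).
  have := coord_is_derive i (heat_dx t (x1 x) (hg n s)).
  move/(@is_deriveZ _ _ _ _ (x1_only s * 4 ^+ n)).
  by rewrite /GRing.scale /= (_ : kron R 0 i * x1_only s * _ * _ =
    x1_only s * 4 ^+ n * (kron R 0 i * heat (derive1 (g n s)) t (x1 x))) //; ring.
Qed.

Lemma spacetime_smooth_static f : scf f -> spacetime_smooth (fun _ x => f (x1 x)).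
Proof.
move=> hf.
pose g (s : seq 'I_6) := derive1n (size s) f.
have hg s : scf (g s) by exact: scf_derive1n.
have gx i s : derive1 (g s) = g (i :: s) by rewrite /g -derive1nS.
exists (fun n s t x => (x1_only s * (n == 0%N)%:R) * g s (x1 x)); split.
- by move=> t x _; rewrite /x1_only /= !mul1r /g derive1n0.
- move=> n s; apply: continuous_subspaceT => p; apply: cvgMr.
  apply: (@continuous_comp _ _ _ snd (fun y : R6 R => g s (x1 y)));
      first exact: cvg_snd.
  exact: (continuous_of_x1 (scf_continuous0 (hg s))).
- move=> n s; have := time_derivative_static
    (fun x => (x1_only s * (n == 0%N)%:R) * g s (x1 x)).
  by under [X in _ -> time_derivative _ X]eq_fun do under eq_fun do rewrite mulr0 mul0r.
- move=> n s i t x t0; rewrite x1_only_cons -(gx i s).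
  have := coord_is_derive i (scf_is_derive0 (x1 x) (hg s)).
  move/(@is_deriveZ _ _ _ _ (x1_only s * (n == 0%N)%:R)).
  rewrite /GRing.scale /= (_ : kron R 0 i * x1_only s * _ * _ =
    x1_only s * (n == 0%N)%:R * (kron R 0 i * derive1 (g s) (x1 x))) //.
  by rewrite -!mulrA mulrCA; congr (_ * _); rewrite mulrCA.
Qed.

End Spacetime.

(** * The flow and its limit *)

Section FlowAndLimit.
Variable R : realType.
Implicit Types (f g h : R -> R) (x : R6 R) (t : R).
Local Notation scf := (@smooth_circle_fun R).
Local Notation x1 x := (x 0 (ix 1)).

(** The hypothesis says that A X^2 + M X + B is a positive function for every
    real X.  A positive linear functional L preserves this, and at the minimum
    X of the polynomial L A X^2 + L M X + L B its value is a positive multiple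
    of 4 L A L B - (L M)^2.  L will be the heat evolution at a point, and the
    mean. *)
Lemma pencil_pos (L : (R -> R) -> R) (A B M : R -> R) :
  (forall a b f g, scf f -> scf g ->
      L (fun y => a * f y + b * g y) = a * L f + b * L g) ->
  (forall c f, scf f -> (forall y, c <= f y) -> c <= L f) ->
  scf A -> scf B -> scf M ->
  (forall y, [/\ 0 < A y, 0 < B y & 0 < 4 * A y * B y - M y ^+ 2]) ->
  [/\ 0 < L A, 0 < L B & 0 < 4 * L A * L B - L M ^+ 2].
Proof.
move=> Llin Lge hA hB hM pos.
have Lpos f : scf f -> (forall y, 0 < f y) -> 0 < L f.
  by move=> hf f0; have [c c0 fc] := scf_gt0_lb hf f0;
      exact: lt_le_trans (Lge c f hf fc).
have LA : 0 < L A by apply: Lpos => // y; case: (pos y).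
have LB : 0 < L B by apply: Lpos => // y; case: (pos y).
split=> //.
pose X := - L M / (2 * L A).
have hAM : scf (fun y => X ^+ 2 * A y + X * M y) by exact: scf_lin.
have := Lpos (fun y => 1 * (X ^+ 2 * A y + X * M y) + 1 * B y) (scf_lin 1 1 hAM hB).
rewrite !Llin // => /(_ _) H.
have {}H : 0 < 1 * (X ^+ 2 * L A + X * L M) + 1 * L B.
  apply: H => y; have [A0 B0 D0] := pos y.
  have A4 : 0 < 4 * A y by rewrite mulr_gt0.
  rewrite -(pmulr_rgt0 _ A4).
  have -> : 4 * A y * (1 * (X ^+ 2 * A y + X * M y) + 1 * B y) =
     (2 * A y * X + M y) ^+ 2 + (4 * A y * B y - M y ^+ 2) by ring.
  by rewrite ltr_wpDl ?sqr_ge0.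
have A4 : 0 < 4 * L A by rewrite mulr_gt0.
suff <- : 4 * L A * (1 * (X ^+ 2 * L A + X * L M) + 1 * L B) = 4 * L A * L B - L M ^+ 2.
  by rewrite pmulr_rgt0.
by rewrite /X; field; rewrite gt_eqF.
Qed.

Lemma heat_sub_mean_cvg f k (e : R) : scf f -> 0 < e ->
  \forall t \near +oo, forall y,
    `|derive1n k (fun y => heat f t y - circle_mean f) y| < e.
Proof.
move=> hf e0.
have E t : (fun y => heat f t y - circle_mean f) =
    (fun y => 1 * heat f t y + (-1) * (fun=> circle_mean f) y).
  by apply/funext => y; rewrite mul1r mulN1r.
case: k => [|k].
  have := heat_cvg_mean hf e0; apply: filterS => t ht y.
  by rewrite derive1n0.
have := heat_derive_cvg0 k hf e0; apply: filterS => t ht y.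
rewrite E derive1n_lin; [|exact: heat_scf|exact: scf_cst].
rewrite heat_derive1n //.
have -> : derive1n k.+1 (fun=> circle_mean f) = fun=> 0.
  elim: k {ht} => [|k IHk]; rewrite derive1nS ?derive1n0 ?IHk;
  by apply: is_derive_eq_derive1 => z; exact: is_derive_cst.
by rewrite mulr0 addr0 mul1r.
Qed.

Lemma derive2_heat (k : R) f t : scf f ->
  derive1 (derive1 (fun y => k * heat f t y)) =
  fun y => k * heat (derive1 (derive1 f)) t y.
Proof.
move=> hf.
have D (h : R -> R) : scf h -> derive1 (fun y => k * h y) = (fun y => k * derive1 h y).
  move=> hh; apply: is_derive_eq_derive1 => u.
  by apply: (@is_deriveZ _ _ _ h); exact: scf_is_derive0.
have H (h : R -> R) : scf h -> derive1 (heat h t) = heat (derive1 h) t.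
  by move=> hh; apply: is_derive_eq_derive1 => u; exact: heat_dx.
by rewrite (D _ (heat_scf t hf)) (H _ hf) (D _ (heat_scf t (scf_derive1 hf)))
    (H _ (scf_derive1 hf)).
Qed.

(** The flow in the coordinates a, b, c - d, which follow the heat equation,
    and c + d, which is constant in time. *)
Definition IIA_flow (A B C D : R -> R) t : tensor_field R 3 :=
  let S y := C y + D y in let M y := C y - D y in
  IIA_form (heat A t) (heat B t)
    (fun y => 2^-1 * S y + 2^-1 * heat M t y)
        (fun y => 2^-1 * S y + - 2^-1 * heat M t y).

Definition IIA_limit (A B C D : R -> R) : tensor_field R 3 :=
  let S y := C y + D y in let m := circle_mean (fun y => C y - D y) in
  IIA_form (fun=> circle_mean A) (fun=> circle_mean B)
    (fun y => 2^-1 * S y + 2^-1 * m) (fun y => 2^-1 * S y + - 2^-1 * m).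

Section Flow.
Variables A B C D : R -> R.
Hypotheses (hA : scf A) (hB : scf B) (hC : scf C) (hD : scf D).
Hypothesis pos : forall y,
  [/\ 0 < A y, 0 < B y & 0 < disc (A y) (B y) (C y) (D y)].

Let S y := C y + D y.
Let M y := C y - D y.
Let hS : scf S. Proof. exact: scf_add. Qed.
Let hM : scf M. Proof. exact: (scf_add hC (scf_opp hD)). Qed.

Lemma heat_pencil t y : [/\ 0 < heat A t y, 0 < heat B t y &
  0 < 4 * heat A t y * heat B t y - heat M t y ^+ 2].
Proof.
apply: (@pencil_pos (fun f => heat f t y)) => //.
- by move=> *; exact: heat_lin.
- by move=> *; exact: heat_ge.
Qed.

Lemma mean_pencil : [/\ 0 < circle_mean A, 0 < circle_mean B &
  0 < 4 * circle_mean A * circle_mean B - circle_mean M ^+ 2].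
Proof.
apply: (@pencil_pos (@circle_mean R)) => //.
- by move=> a b f g hf hg; apply: circle_mean_lin; exact: scf_continuous0.
- by move=> c f hf; apply: circle_mean_ge; exact: scf_continuous0.
Qed.

Lemma disc_flow t y : disc (heat A t y) (heat B t y)
  (2^-1 * S y + 2^-1 * heat M t y) (2^-1 * S y + - 2^-1 * heat M t y) =
  4 * heat A t y * heat B t y - heat M t y ^+ 2.
Proof. by rewrite /disc; field. Qed.

Let hp t : scf (fun y => 2^-1 * S y + 2^-1 * heat M t y).
Proof. exact: (scf_lin _ _ hS (heat_scf t hM)). Qed.
Let hm t : scf (fun y => 2^-1 * S y + - 2^-1 * heat M t y).
Proof. exact: (scf_lin _ _ hS (heat_scf t hM)). Qed.

Lemma IIA_flow0 : IIA_flow A B C D 0 = IIA_form A B C D.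
Proof.
rewrite /IIA_flow !heat0; by congr IIA_form; apply/funext => y; field.
Qed.

Let E (I : 3.-tuple 'I_6) e : R := list_det R (slot e) (nat_indices I).
Let wA (I : 3.-tuple 'I_6) := E I (false, false, false).
Let wB (I : 3.-tuple 'I_6) := - E I (false, true, true).
Let wM (I : 3.-tuple 'I_6) :=
  2^-1 * (E I (false, false, true) - E I (false, true, false)).
Let wS (I : 3.-tuple 'I_6) :=
  2^-1 * (E I (false, false, true) + E I (false, true, false)).
Let w1 (I : 3.-tuple 'I_6) := - (E I (true, false, true) + E I (true, true, false)).

(** Each component is a linear combination, with constant weights, of three
    solutions of the heat equation and two fields constant in time. *)
Lemma IIA_flowE I : (fun t x => IIA_flow A B C D t x I) = fun t x =>
  1 * (wA I * heat A t (x1 x) + wB I * heat B t (x1 x))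
  + 1 * (wM I * heat M t (x1 x) + 1 * (wS I * S (x1 x) + 1 * w1 I)).
Proof.
apply/funext => t; apply/funext => x.
rewrite /IIA_flow /IIA_form /split_form slots_sum /phi_slots -!/(S _) -!/(E _ _).
rewrite -[heat (fun y => C y - D y)]/(heat M) /wA /wB /wM /wS /w1.
by field.
Qed.

Lemma IIA_flow_smooth I : spacetime_smooth (fun t x => IIA_flow A B C D t x I).
Proof.
rewrite IIA_flowE.
apply: spacetime_smooth_lin.
  by apply: spacetime_smooth_lin; exact: spacetime_smooth_heat.
apply: spacetime_smooth_lin; first exact: spacetime_smooth_heat.
apply: spacetime_smooth_lin; first exact: (spacetime_smooth_static hS).
exact: (spacetime_smooth_static (scf_cst _)).
Qed.

Lemma IIA_flow_dt I : time_derivative (fun t x => IIA_flow A B C D t x I)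
  (fun t x => typeIIA_rhs (IIA_flow A B C D t) x I).
Proof.
have h := @time_derivative_lin _ 1 1 _ _ _ _
  (@time_derivative_lin _ (wA I) (wB I) _ _ _ _
     (time_derivative_heat hA) (time_derivative_heat hB))
  (@time_derivative_lin _ (wM I) 1 _ _ _ _ (time_derivative_heat hM)
     (@time_derivative_lin _ (wS I) 1 _ _ _ _
        (time_derivative_static (fun x => S (x1 x)))
        (time_derivative_static (fun=> w1 I)))).
rewrite IIA_flowE => t x t0; have := h t x t0.
suff -> : typeIIA_rhs (IIA_flow A B C D t) x I =
  1 * (wA I * (4 * heat (derive1 (derive1 A)) t (x1 x)) +
       wB I * (4 * heat (derive1 (derive1 B)) t (x1 x))) +
  1 * (wM I * (4 * heat (derive1 (derive1 M)) t (x1 x)) +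
       1 * (wS I * 0 + 1 * 0)) by [].
have D0 y : 0 < disc (heat A t y) (heat B t y) (2^-1 * S y + 2^-1 * heat M t y)
                 (2^-1 * S y + - 2^-1 * heat M t y).
  by rewrite disc_flow; case: (heat_pencil t y).
rewrite (typeIIA_rhs_IIA (heat_scf t hA) (heat_scf t hB) (hp t) (hm t) D0 x I).
pose X z z' := derive1 (derive1 (fun y =>
  star_slots (heat A t y) (heat B t y) (2^-1 * S y + 2^-1 * heat M t y)
    (2^-1 * S y + - 2^-1 * heat M t y) (true, z, z'))) (x1 x).
have XE k f z z' : scf f -> (fun y =>
  star_slots (heat A t y) (heat B t y) (2^-1 * S y + 2^-1 * heat M t y)
    (2^-1 * S y + - 2^-1 * heat M t y) (true, z, z')) = (fun y => k * heat f t y) ->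
  X z z' = k * heat (derive1 (derive1 f)) t (x1 x).
  by move=> hf e; rewrite /X e derive2_heat.
have X00 : X false false = 2 * heat (derive1 (derive1 A)) t (x1 x) by exact: XE.
have X01 : X false true = 1 * heat (derive1 (derive1 M)) t (x1 x).
  by apply: XE => //; apply/funext => y; rewrite /star_slots; field.
have X10 : X true false = -1 * heat (derive1 (derive1 M)) t (x1 x).
  by apply: XE => //; apply/funext => y; rewrite /star_slots; field.
have X11 : X true true = - 2 * heat (derive1 (derive1 B)) t (x1 x) by exact: XE.
rewrite -[LHS]/(split_form (fun e => if e.1.1 then 0 else 2 * X e.1.2 e.2) I).
clearbody X; rewrite /split_form slots_sum -!/(E _ _) /=.
rewrite X00 X01 X10 X11 /wA /wB /wM.
generalize (heat (derive1 (derive1 A)) t (x1 x)) (heat (derive1 (derive1 B)) t (x1 x))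
  (heat (derive1 (derive1 M)) t (x1 x)) (E I) => u v w F.
by field.
Qed.

Lemma IIA_limit_props :
  [/\ torus_form (IIA_limit A B C D), primitive_form (IIA_limit A B C D),
      positive_form (IIA_limit A B C D) & harmonic_form (IIA_limit A B C D)].
Proof.
have [a0 b0 D0] := mean_pencil.
have hc : scf (fun y => 2^-1 * S y + 2^-1 * circle_mean M).
  exact: (scf_lin _ _ hS (scf_cst _)).
have hd : scf (fun y => 2^-1 * S y + - 2^-1 * circle_mean M).
  exact: (scf_lin _ _ hS (scf_cst _)).
split.
- exact: (IIA_form_torus (scf_cst _) (scf_cst _) hc hd).
- exact: IIA_form_primitive.
- apply: IIA_form_positive => y; split=> //; rewrite /disc.
  suff <- : 4 * circle_mean A * circle_mean B - circle_mean M ^+ 2 =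
    4 * circle_mean A * circle_mean B - (2^-1 * S y + 2^-1 * circle_mean M -
      (2^-1 * S y + - 2^-1 * circle_mean M)) ^+ 2 by [].
  by field.
- apply: (IIA_form_harmonic (m := circle_mean M) hc hd) => // y.
  by field.
Qed.

Lemma IIA_flow_cvg : converges_smoothly (IIA_flow A B C D) (IIA_limit A B C D).
Proof.
move=> s I e e0.
pose w f t y := heat f t y - circle_mean f.
have hw f t : scf f -> scf (w f t).
  by move=> hf; exact: (scf_add (heat_scf t hf) (scf_opp (scf_cst _))).
pose h t y := 1 * (wA I * w A t y + wB I * w B t y) + wM I * w M t y.
have hAB t : scf (fun y => wA I * w A t y + wB I * w B t y).
  exact: (scf_lin _ _ (hw A t hA) (hw B t hB)).
have hh t : scf (h t) by exact: (scf_lin _ _ (hAB t) (hw M t hM)).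
have E1 t : (fun y => IIA_flow A B C D t y I - IIA_limit A B C D y I) =
    (fun y : R6 R => h t (x1 y)).
  apply/funext => y.
  have -> := congr1 (fun F => F t y) (IIA_flowE I).
  rewrite /IIA_limit /IIA_form /split_form slots_sum /phi_slots -!/(S _) -!/(E _ _).
  rewrite -/M /h /w /wA /wB /wM /wS /w1.
  by field.
pose K := `|wA I| + `|wB I| + `|wM I| + 1.
have K0 : 0 < K by rewrite ltr_wpDl // !addr_ge0.
have eK : 0 < e / K by rewrite divr_gt0.
near=> t => x; rewrite E1 pderivs_coord //.
have bA : forall y, `|derive1n (size s) (w A t) y| < e / K.
  by near: t; exact: heat_sub_mean_cvg.
have bB : forall y, `|derive1n (size s) (w B t) y| < e / K.
  by near: t; exact: heat_sub_mean_cvg.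
have bM : forall y, `|derive1n (size s) (w M t) y| < e / K.
  by near: t; exact: heat_sub_mean_cvg.
apply: (@le_lt_trans _ _ `|derive1n (size s) (h t) (x1 x)|).
  by rewrite normrM; case: all; rewrite ?normr1 ?mul1r ?normr0 ?mul0r.
rewrite /h derive1n_lin //; last exact: hw.
rewrite derive1n_lin; [|exact: hw|exact: hw].
rewrite mul1r (le_lt_trans (ler_normD _ _)) //.
apply: (@le_lt_trans _ _ ((`|wA I| + `|wB I| + `|wM I|) * (e / K))).
  rewrite !mulrDl lerD //.
    rewrite (le_trans (ler_normD _ _)) // lerD // normrM ler_wpM2l //; exact: ltW.
  by rewrite normrM ler_wpM2l //; exact: ltW.
rewrite mulrCA -[ltRHS]mulr1 ltr_pM2l // ltr_pdivrMr // mul1r /K.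
by rewrite ltrDl.
Unshelve. all: by end_near. Qed.

Lemma IIA_flow_typeIIA : typeIIA_flow (IIA_flow A B C D).
Proof.
split=> [t _|I|I]; [|exact: IIA_flow_smooth|exact: IIA_flow_dt].
have hAt := heat_scf t hA; have hBt := heat_scf t hB.
split.
- exact: (IIA_form_torus hAt hBt (hp t) (hm t)).
- exact: (IIA_form_closed hAt hBt (hp t) (hm t)).
- exact: IIA_form_primitive.
- apply: IIA_form_positive => y; have [a0 b0 D0] := heat_pencil t y.
  by split=> //; rewrite disc_flow.
Qed.

End Flow.
End FlowAndLimit.

Theorem theorem10 (R : realType) (alpha beta gamma delta : R -> R)
  (halpha : smooth_circle_fun alpha) (hbeta : smooth_circle_fun beta)
  (hgamma : smooth_circle_fun gamma) (hdelta : smooth_circle_fun delta)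
  (hpos : positive_form (phi_init alpha beta gamma delta))
  (hnonint : ~ integrable_acs
     (fun x => J_mx (phi_init alpha beta gamma delta x))) :
  exists phi : R -> tensor_field R 3,
    [/\ typeIIA_flow phi,
        phi 0 = phi_init alpha beta gamma delta
      & exists phi_oo : tensor_field R 3,
          [/\ torus_form phi_oo, primitive_form phi_oo, positive_form phi_oo,
              harmonic_form phi_oo & converges_smoothly phi phi_oo]].
Proof.
have hA := scf_expR halpha; have hB := scf_expR hbeta.
have pos y : [/\ 0 < expR (alpha y), 0 < expR (beta y) &
    0 < disc (expR (alpha y)) (expR (beta y)) (gamma y) (delta y)].
  by split; [exact: expR_gt0|exact: expR_gt0|
    move: hpos; rewrite phi_initE => /positive_disc/(_ y)].
exists (IIA_flow (fun y => expR (alpha y)) (fun y => expR (beta y)) gamma delta).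
split; first exact: IIA_flow_typeIIA.
  by rewrite IIA_flow0 phi_initE.
exists (IIA_limit (fun y => expR (alpha y)) (fun y => expR (beta y)) gamma delta).
have [] := IIA_limit_props hA hB hgamma hdelta pos.
by split=> //; exact: IIA_flow_cvg.
Qed.
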